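(* Let $\mathsf S$ be a simple polytope with the origin in its interior, and let $\mathrm B$ be a building set for $\mathsf S$. Let $\mathsf P$ be a truncation of $\mathsf S$ along $\mathrm B$ (a $\mathrm B$-truncation), and let $\Psi=\Sigma(\mathsf P)$ be its normal fan. The shallow truncations of $\mathsf S$ along the individual faces in $\mathrm B$ (one shallow truncation for each $\mathsf F\in\mathrm B$) form a polytopal basis for the deformation cone of $\Psi$. The Minkowski sum of these truncations is normally equivalent to $\mathsf P$ (i.e. has the same normal fan as $\mathsf P$). When $\mathsf S$ is smooth with all edges of lattice length $1$, the corresponding flat truncations $\operatorname{DTr}[\mathsf S,\mathsf F]$, $\mathsf F\in\mathrm B$, form a polytopal basis for the deformation cone of $\Psi$.
   Context: Conventions. Let $\Lambda$ be a lattice (by default $\mathbb Z^n\subset\mathbb R^n$) and $V=\Lambda\otimes\mathbb R$. Polytopes live in $V$; normal vectors live in $V^*$, which contains the dual lattice $\Lambda^*$ (for $\mathbb R^n$ everything is identified via the dot product). All polytopes are assumed to have rational facet normals. The support function is $h(\mathsf P,u)=\min_{x\in\mathsf P}u\cdot x$. For a nonempty face $\mathsf F$ of $\mathsf P$, its normal cone is $\{u : u\cdot x=h(\mathsf P,u)\ \forall x\in\mathsf F\}$; the normal fan $\Sigma(\mathsf P)$ is the collection of normal cones of all nonempty faces. A fan $\Sigma_2$ coarsens $\Sigma_1$ if every cone of $\Sigma_2$ is a union of cones of $\Sigma_1$. Face normals. Let $\mathsf S$ be a full-dimensional simple polytope (having the origin in the interior includes being full-dimensional). For a facet $\mathsf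 G$, $u_{\mathsf G}\in\Lambda^*$ is its primitive inner normal; for a nonempty proper face $\mathsf F$, $u_{\mathsf F}=\sum_{\mathsf G\supseteq\mathsf F}u_{\mathsf G}$, summed over the facets containing $\mathsf F$. Truncations. For a nonempty proper face $\mathsf F$ and $\epsilon>0$, $\operatorname{Tr}_\epsilon[\mathsf S,\mathsf F]=\{x\in\mathsf S : u_{\mathsf F}\cdot x\ge h(\mathsf S,u_{\mathsf F})+\epsilon\}$. A vertex $y\notin\mathsf F$ is a neighbor of $\mathsf F$ if it is joined by an edge of $\mathsf S$ to a vertex of $\mathsf F$; $\delta_{\mathsf F}=\min\{u_{\mathsf F}\cdot y-h(\mathsf S,u_{\mathsf F}) : y\text{ a neighbor of }\mathsf F\}$. The truncation is shallow if $0<\epsilon<\delta_{\mathsf F}$; the deep truncation is $\operatorname{DTr}[\mathsf S,\mathsf F]=\operatorname{Tr}_{\delta_{\mathsf F}}[\mathsf S,\mathsf F]$; it is flat if it equals the convex hull of the vertices of $\mathsf S$ not in $\mathsf F$ (this holds for all faces when $\mathsf S$ is smooth with edges of lattice length 1). Building sets. A set $\mathrm B$ of nonempty proper faces of a simple polytope $\mathsf S$ is a building set for $\mathsf S$ if (1) $\mathrm B$ contains all facets; (2) whenever $\mathsf F,\mathsf G\in\mathrm B$ satisfy $\mathsf F\cap\mathsf G\neq\emptyset$ and some facet contains both $\mathsf F$ and $\mathsf G$, then $\mathsf F\cap\mathsf G\in\mathrm B$. (Equivalently, the normal cones of the faces in $\mathrm B$ contain all rays, and if two of them intersect nontrivially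 and their convex hull is a cone of $\Sigma(\mathsf S)$, then that cone is also among them.) $\mathrm B$-truncation. List $\mathrm B$ as $\mathsf F_1,\dots,\mathsf F_m$ in an order extending inclusion (smaller faces first), let $\mathsf S_0=\mathsf S$, and for numbers $\epsilon_{\mathsf F}>0$ let $\mathsf S_i=\operatorname{Tr}_{\epsilon_{\mathsf F_i}}[\mathsf S_{i-1},\mathsf F_i\cap\mathsf S_{i-1}]$ (truncating in direction $u_{\mathsf F_i}$). If each of these truncations is shallow, $\mathsf S_m$ is called a $\mathrm B$-truncation of $\mathsf S$. Deformations. For a complete polytopal fan $\Psi$ in $V^*$, $\operatorname{PL}(\Psi)$ is the vector space of functions on $V^*$ that are linear on each cone of $\Psi$. The deformation cone $\operatorname{Def}(\Psi)\subseteq\operatorname{PL}(\Psi)$ is the set of support functions of polytopes whose normal fan coarsens $\Psi$. A polytopal basis for the deformation cone of $\Psi$ is a collection of polytopes with normal fans coarsening $\Psi$ whose support functions form a basis of $\operatorname{PL}(\Psi)$. Smoothness. A full-dimensional polytope with vertices in $\Lambda$ is smooth (Delzant) if at every vertex the primitive lattice vectors along the incident edges form a basis of $\Lambda$. An edge has lattice length $1$ if its only lattice points are its endpoints. *)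

(* Defs.v *)
From mathcomp Require Import all_boot all_order all_algebra.
From mathcomp Require Import all_classical all_reals topology.
Import Order.TTheory GRing.Theory Num.Theory.
Import numFieldTopology.Exports.

Set Implicit Arguments.
Unset Strict Implicit.
Unset Printing Implicit Defensive.

Local Open Scope classical_set_scope.
Local Open Scope ring_scope.

Section Polytopes.
Context {R : realType} {n : nat}.

(* V and its dual are both identified with R^n through the dot product; the
   lattice and its dual are both Z^n. *)
Local Notation V := 'rV[R]_n.
Implicit Types (P F G E Q : set V) (u v w x y : V) (B : set (set V)).

Definition dot u x : R := \sum_i u 0 i * x 0 i.

Definition conv (X : set V) : set V :=
  [set x | exists (k : nat) (p : 'I_k -> V) (c : 'I_k -> R),
     [/\ forall i, X (p i), forall i, 0 <= c i, \sum_i c i = 1 &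
         x = \sum_i c i *: p i]].

(* Rationality of the facet normals is a separate predicate,
   [rational_facets] below. *)
Definition polytope P : Prop :=
  exists X : set V, [/\ finite_set X, X !=set0 & P = conv X].

(* On a polytope this infimum is attained. *)
Definition supp P u : R := inf [set dot u x | x in P].

Definition face_in P u : set V := [set x | P x /\ dot u x = supp P u].

Definition is_face P F : Prop := exists u, F = face_in P u.

Definition proper_face P F : Prop := [/\ is_face P F, F !=set0 & F <> P].

(* [A] has affine dimension [k]: [x0] and the [x0 + row i M] are [k + 1]
   affinely independent points of [A] whose affine span contains [A]. *)
Definition has_dim (A : set V) (k : nat) : Prop :=
  exists (x0 : V) (M : 'M[R]_(k, n)),
    [/\ A x0, row_free M, forall i, A (x0 + row i M) &
        forall x, A x -> (x - x0 <= M)%MS].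

Definition vertex P v : Prop := is_face P [set v].

Definition edge P E : Prop := is_face P E /\ has_dim E 1.

Definition facet P G : Prop :=
  is_face P G /\ exists k, has_dim P k.+1 /\ has_dim G k.

Definition simple_polytope P : Prop :=
  [/\ polytope P, has_dim P n &
      forall v, vertex P v -> ([set G | facet P G /\ G v] #= `I_n)%card].

Definition normal_cone P F : set V :=
  [set u | forall x, F x -> dot u x = supp P u].

Definition normal_fan P : set (set V) :=
  [set normal_cone P F | F in [set F | is_face P F /\ F !=set0]].

Definition coarsens (Sigma2 Sigma1 : set (set V)) : Prop :=
  forall C, Sigma2 C ->
    exists A : set (set V), A `<=` Sigma1 /\ C = \bigcup_(D in A) D.

Definition lattice u : Prop := forall i, u 0 i \is a Num.int.

(* Taking w = 0 and k = 2 shows that 0 is not primitive. *)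
Definition primitive u : Prop :=
  lattice u /\
  forall (k : nat) w, lattice w -> u = k%:R *: w -> k = 1%N.

(* Such a [u] is automatically nonzero, since [face_in P 0 = P]. *)
Definition rational_facets P : Prop :=
  forall G, facet P G -> exists u, lattice u /\ G = face_in P u.

(* For a facet [G] of a full-dimensional polytope with rational facet normals,
   exactly one primitive [u] satisfies [G = face_in P u]; it points inwards
   because [supp] is a minimum. *)
Definition facet_normal P G : V :=
  xget 0 [set u | primitive u /\ G = face_in P u].

Definition face_normal P F : V :=
  \sum_(G \in [set G | facet P G /\ F `<=` G]) facet_normal P G.

(* Truncations are parametrized by the direction [u], because the successive
   truncations of a [building_truncation] use normals computed in the original
   polytope. *)
Definition truncation P u (e : R) : set V :=
  [set x | P x /\ supp P u + e <= dot u x].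

Definition neighbor P F y : Prop :=
  [/\ vertex P y, ~ F y &
      exists v E, [/\ vertex P v, F v, edge P E, E v & E y]].

Definition depth P F u : R :=
  inf [set dot u y - supp P u | y in neighbor P F].

Definition shallow P F u (e : R) : Prop :=
  proper_face P F /\ 0 < e < depth P F u.

Definition Tr (e : R) P F : set V := truncation P (face_normal P F) e.

Definition shallow_face P F (e : R) : Prop := shallow P F (face_normal P F) e.

Definition DTr P F : set V := Tr (depth P F (face_normal P F)) P F.

Definition flat P F : Prop := DTr P F = conv [set v | vertex P v /\ ~ F v].

Definition building_set P B : Prop :=
  [/\ forall F, B F -> proper_face P F,
      forall G, facet P G -> B G &
      forall F G, B F -> B G -> F `&` G !=set0 ->
        (exists H, [/\ facet P H, F `<=` H & G `<=` H]) -> B (F `&` G)].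

(* The successive polytopes S_0 = S, S_1, ..., S_m. *)
Definition truncation_step S (s : seq (set V)) (eps : set V -> R) (i : nat) :
    set V :=
  foldl (fun Q F => truncation Q (face_normal S F) (eps F)) S (take i s).

Definition building_truncation S B P : Prop :=
  exists (s : seq (set V)) (eps : set V -> R),
    [/\ uniq s /\ [set` s] = B,
        forall F G, F \in s -> G \in s -> F `<=` G ->
          (index F s <= index G s)%N,
        forall i, (i < size s)%N ->
          let Q := truncation_step S s eps i in
          let F := nth set0 s i in
          shallow Q (F `&` Q) (face_normal S F) (eps F) &
        P = truncation_step S s eps (size s)].

Definition PL (Psi : set (set V)) : set (V -> R) :=
  [set f | forall C, Psi C -> exists a, forall u, C u -> f u = dot a u].

Definition basis_of_PL (Psi B : set (set V)) (f : set V -> V -> R) : Prop :=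
  [/\ finite_set B,
      forall F, B F -> PL Psi (f F),
      forall c : set V -> R, (forall u, \sum_(F \in B) c F * f F u = 0) ->
        forall F, B F -> c F = 0 &
      forall g, PL Psi g ->
        exists c : set V -> R, forall u, g u = \sum_(F \in B) c F * f F u].

(* The collection is the family [Q F] indexed by [F] in [B]. *)
Definition polytopal_basis (Psi B : set (set V)) (Q : set V -> set V) : Prop :=
  (forall F, B F -> polytope (Q F) /\ coarsens (normal_fan (Q F)) Psi) /\
  basis_of_PL Psi B (fun F => supp (Q F)).

Definition minkowski_sum B (Q : set V -> set V) : set V :=
  [set x | exists y : set V -> V,
     (forall F, B F -> Q F (y F)) /\ x = \sum_(F \in B) y F].

Definition normally_equivalent P Q : Prop := normal_fan P = normal_fan Q.

Definition lattice_basis (X : set V) : Prop :=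
  [/\ finite_set X,
      X `<=` lattice,
      forall c : V -> int, \sum_(w \in X) w *~ c w = 0 ->
        forall w, X w -> c w = 0 &
      forall u, lattice u -> exists c : V -> int, u = \sum_(w \in X) w *~ c w].

Definition edge_direction P v w : Prop :=
  primitive w /\
  exists E (t : R), [/\ edge P E, E v, 0 < t & E (v + t *: w)].

Definition smooth_polytope P : Prop :=
  [/\ polytope P, has_dim P n,
      forall v, vertex P v -> lattice v &
      forall v, vertex P v -> lattice_basis (edge_direction P v)].

Definition lattice_length1 E : Prop :=
  forall x, E x -> (lattice x <-> vertex E x).

End Polytopes.

(* Main.v *)
Require Import Defs.
From mathcomp Require Import all_boot all_order all_algebra.
From mathcomp Require Import finmap ring lra.
From mathcomp Require Import all_classical all_reals topology.
Import Order.TTheory GRing.Theory Num.Theory.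
Import numFieldTopology.Exports.
Local Open Scope classical_set_scope.
Local Open Scope ring_scope.

(* Write [slack F] for the difference between the linear form of [F] and its
   minimum on [S]; it is the sum of the slacks of the facets containing [F].  The
   polytope [P] is cut out by [eps F <= slack F], [F] in [B], so by Farkas' lemma
   its normal cones are generated by the normals of active faces.  Undoing the
   shallow cuts one at a time shows that active faces have a common point, and
   that an intersection of active faces which lies in [B] is itself active.
   Hence, given a point of [P] and [G] in [B], some facet through [G] contains an
   active face only if that face lies in [G]; leaving a common vertex of the active
   faces along the edge not in that facet, one finds a point of the truncation at
   [G] minimizing all active normals at once.  So every truncation has a support
   function linear on the normal cones of [P].

   The value of the support function of the truncation at [F] on the normal of [G]
   is [h G], plus [eps F] if [G] lies in [F].  This matrix is the sum of a rank-one
   matrix and a triangular one, and is invertible unless the slacks at the origin,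
   divided by [eps], add up to 1 over the facets.  They add up to more: in the
   shallow case already because this holds at every vertex, in the smooth case
   because they are positive integers.  As a function in [PL] is determined by its
   values on the normals of [B], the support functions form a basis.  Then the
   support function of [P] is one of their combinations, so it is linear wherever
   that of the Minkowski sum is, and the two normal fans agree. *)

Section TruncationBases.
Set Implicit Arguments.
Unset Strict Implicit.

(** * Bilinearity and positivity of the dot product *)

Section DotProduct.
Context {R : realType} {n : nat}.
Local Notation V := 'rV[R]_n.
Implicit Types (u v x y : V) (a : R).

Lemma dotC u v : dot u v = dot v u.
Proof. by apply: eq_bigr => i _; rewrite mulrC. Qed.

Lemma dotDr u x y : dot u (x + y) = dot u x + dot u y.
Proof. by rewrite /dot -big_split; apply: eq_bigr => i _; rewrite mxE mulrDr. Qed.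

Lemma dotZr u a x : dot u (a *: x) = a * dot u x.
Proof. by rewrite /dot mulr_sumr; apply: eq_bigr => i _; rewrite mxE mulrCA. Qed.

Lemma dotNr u x : dot u (- x) = - dot u x.
Proof. by rewrite -scaleN1r dotZr mulN1r. Qed.

Lemma dotBr u x y : dot u (x - y) = dot u x - dot u y.
Proof. by rewrite dotDr dotNr. Qed.

Lemma dotDl u v x : dot (u + v) x = dot u x + dot v x.
Proof. by rewrite dotC dotDr !(dotC x). Qed.

Lemma dotZl u a x : dot (a *: u) x = a * dot u x.
Proof. by rewrite dotC dotZr dotC. Qed.

Lemma dotNl u x : dot (- u) x = - dot u x.
Proof. by rewrite dotC dotNr dotC. Qed.

Lemma dotBl u v x : dot (u - v) x = dot u x - dot v x.
Proof. by rewrite dotDl dotNl. Qed.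

Lemma dot0r u : dot u 0 = 0.
Proof. by rewrite -(scale0r 0) dotZr mul0r. Qed.

Lemma dot0l u : dot 0 u = 0.
Proof. by rewrite dotC dot0r. Qed.

Definition dotE := (dotDr, dotBr, dotZr, dotNr, dotDl, dotBl, dotZl, dotNl, dot0r, dot0l).

Lemma dot_sumr (I : Type) (s : seq I) (Q : pred I) u (f : I -> V) :
  dot u (\sum_(i <- s | Q i) f i) = \sum_(i <- s | Q i) dot u (f i).
Proof. by apply: (big_morph (dot u)); [exact: dotDr | exact: dot0r]. Qed.

Lemma dot_suml (I : Type) (s : seq I) (Q : pred I) u (f : I -> V) :
  dot (\sum_(i <- s | Q i) f i) u = \sum_(i <- s | Q i) dot (f i) u.
Proof. by rewrite dotC dot_sumr; apply: eq_bigr => i _; rewrite dotC. Qed.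

Lemma dot_mulmx u x : u *m x^T = (dot u x)%:M.
Proof.
by rewrite [LHS]mx11_scalar mxE; congr (_%:M); apply: eq_bigr => i _; rewrite mxE.
Qed.

Lemma dot_eq0 u : (dot u u == 0) = (u == 0).
Proof.
apply/eqP/eqP => [u0|->]; last by rewrite dot0l.
apply/rowP => i; rewrite mxE; apply/eqP; rewrite -sqrf_eq0 expr2.
move/eqP: u0; rewrite psumr_eq0 => [/allP/(_ i)|j _]; last by rewrite -expr2 sqr_ge0.
by rewrite mem_index_enum => /(_ isT).
Qed.

Lemma dot_gt0 u : u != 0 -> 0 < dot u u.
Proof.
rewrite -dot_eq0 lt0r => -> /=.
by apply: sumr_ge0 => i _; rewrite -expr2 sqr_ge0.
Qed.

End DotProduct.

(** * Finitely generated cones and Farkas' lemma *)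

Section Farkas.
Context {R : realType} {n : nat}.
Local Notation V := 'rV[R]_n.
Implicit Types (a b d : V) (s : seq V).

(** Recursive in the list, so that Farkas' lemma can peel off one generator at a time; [in_cone_nth]
    and [in_cone_uniq] recover the usual sum. *)
Fixpoint in_cone s b : Prop :=
  if s is a :: s' then exists2 c : R, 0 <= c & in_cone s' (b - c *: a) else b = 0.

(** The parts [f x *: a] of the sheared generators, collected with their nonnegative coefficients,
    make up the multiple [c] of [a]. *)
Lemma in_cone_shear s (f : V -> R) a b :
  (forall x, x \in s -> 0 <= f x) -> in_cone [seq x + f x *: a | x <- s] b ->
  exists2 c : R, 0 <= c & in_cone s (b - c *: a).
Proof.
elim: s b => [|x s IH] b f0 /=; first by move=> ->; exists 0; rewrite // scale0r subr0.
case=> c c0 /IH[y ys|c' c'0 h]; first by apply: f0; rewrite inE ys orbT.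
exists (c * f x + c'); first by rewrite addr_ge0 ?mulr_ge0 ?f0 ?mem_head.
exists c => //; congr (in_cone s _): h.
by apply/rowP => i; rewrite !mxE; ring.
Qed.

(* The cone generated by [a :: s], seen from outside along [a], is the cone
   generated by the projections of [s] to the hyperplane [dot _ d = 0]. *)
Lemma farkas s b :
  in_cone s b \/ exists d, (forall a, a \in s -> 0 <= dot a d) /\ dot b d < 0.
Proof.
elim: {s}(size s) {-2}s (erefl (size s)) b => [|k IH] [|a s] //= => [_|[sk]] b.
  have [->|b0] := eqVneq b 0; [by left | right].
  by exists (- b); split=> //; rewrite dotNr oppr_lt0 dot_gt0.
have [inb|[d [ds bd]]] := IH s sk b.
  by left; exists 0; rewrite // scale0r subr0.
have [ad|ad] := leP 0 (dot a d).
  by right; exists d; split=> // x; rewrite inE => /predU1P[->|/ds].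
have a0 : dot a d != 0 by rewrite lt_eqF.
pose f x := - (dot x d / dot a d).
have f0 x : x \in s -> 0 <= f x.
  by move=> /ds xd; rewrite /f -mulrN -invrN divr_ge0 // oppr_ge0 ltW.
have [|inb|[d' [ds' bd']]] := IH [seq x + f x *: a | x <- s] _ (b + f b *: a).
- by rewrite size_map.
- left; have [c c0 h] := in_cone_shear f0 inb; exists (c - f b).
    by rewrite /f opprK addr_ge0 // nmulr_rge0 // invr_le0 ltW.
  by congr (in_cone s _): h; apply/rowP => i; rewrite !mxE; ring.
right; exists (d' - (dot a d' / dot a d) *: d).
have e x : dot x (d' - (dot a d' / dot a d) *: d) = dot (x + f x *: a) d'.
  by rewrite !dotE /f; ring.
split=> [x|]; last by rewrite e.
rewrite inE => /predU1P[->|xs]; last by rewrite e; apply/ds'/mapP; exists x.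
by rewrite !dotE divfK // subrr.
Qed.

Lemma in_cone_nth s b : in_cone s b ->
  exists2 c : nat -> R, forall i, 0 <= c i & b = \sum_(i < size s) c i *: s`_i.
Proof.
elim: s b => [|a s IH] b /=; first by move=> ->; exists (fun=> 0); rewrite ?big_ord0.
case=> c c0 /IH[f f0 e]; exists (fun i => if i is j.+1 then f j else c).
  by case.
by rewrite big_ord_recl /= -e addrC subrK.
Qed.

Lemma in_cone_uniq (T : choiceType) (s : seq T) (f : T -> V) b :
  uniq s -> in_cone (map f s) b ->
  exists2 c : T -> R, forall i, 0 <= c i & b = \sum_(i <- s) c i *: f i.
Proof.
move=> us /in_cone_nth[c c0 ->]; exists (fun t => c (index t s)) => // .
case: s us => [|t s] us; first by rewrite big_nil big_ord0.
rewrite (big_nth t) big_mkord size_map; apply: eq_bigr => i _.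
by rewrite index_uniq // (nth_map t).
Qed.

End Farkas.

(** * Minima over finite lists and large multipliers *)

Section FiniteExtrema.
Context {R : realType}.

Lemma seq_argmin (T : eqType) (s : seq T) (f : T -> R) :
  s != [::] -> exists2 x, x \in s & forall y, y \in s -> f x <= f y.
Proof.
elim: s => // a [_ _|b s /(_ isT)[x xs xm] _].
  by exists a; rewrite ?mem_head // => y; rewrite inE => /eqP->.
have [ax|xa] := leP (f a) (f x).
  exists a; rewrite ?mem_head // => y; rewrite inE => /predU1P[->//|/xm].
  exact: le_trans.
exists x; first by rewrite inE xs orbT.
by move=> y; rewrite inE => /predU1P[->|/xm //]; exact: ltW.
Qed.

(** The common source of perturbation arguments below: where [k] is positive a large multiple of it
    outweighs [f], and finitely many entries need only one bound. *)
Lemma big_multiplier (T : eqType) (s : seq T) (f k : T -> R) :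
  (forall x, x \in s -> 0 <= k x) -> (forall x, x \in s -> k x = 0 -> 0 <= f x) ->
  exists2 L : R, 0 < L &
    forall l, L <= l -> forall x, x \in s -> 0 <= f x + l * k x.
Proof.
elim: s => [|a s IH] k0 f0; first by exists 1.
have [x xs|x xs|L L0 h] := IH; [by apply: k0; rewrite inE xs orbT|by apply: f0; rewrite inE xs orbT|].
have [ka|ka] := eqVneq (k a) 0.
  exists L => // l Ll x; rewrite inE => /predU1P[->|]; last exact: h.
  by rewrite ka mulr0 addr0 f0 ?mem_head.
have ka0 : 0 < k a by rewrite lt0r ka k0 ?mem_head.
exists (L + `|f a| / k a); first by rewrite ltr_wpDr // divr_ge0 // ltW.
move=> l Ll x; rewrite inE => /predU1P[->|xs].
  have : `|f a| / k a <= l by apply: le_trans Ll; rewrite lerDr ltW.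
  rewrite ler_pdivrMr // => fl; have := ler_norm (- f a); rewrite normrN.
  lra.
by apply: h => //; apply: le_trans Ll; rewrite lerDl divr_ge0 // ltW.
Qed.

End FiniteExtrema.

(** * Convex hulls and support functions *)

Section ConvexHull.
Context {R : realType} {n : nat}.
Local Notation V := 'rV[R]_n.
Implicit Types (u v x y g : V) (P Q F : set V) (xs : seq V).

Lemma dot_row_mx m (u x : V) (a b : 'rV[R]_m) :
  dot (row_mx u a) (row_mx x b) = dot u x + dot a b.
Proof.
rewrite /dot big_split_ord; congr (_ + _); apply: eq_bigr => i _.
  by rewrite !row_mxEl.
by rewrite !row_mxEr.
Qed.

(** Hulls are handled through their valid inequalities from here on. For the converse, Farkas' lemma
    is applied to points lifted to height 1: the extra coordinate makes the coefficients add up to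
    1, and a separating vector splits into [g] and the constant [c]. *)
Lemma convP xs x :
  conv [set` xs] x <->
  forall g (c : R), (forall p, p \in xs -> c <= dot g p) -> c <= dot g x.
Proof.
split=> [[k [p [a [pX a0 a1 ->]]]] g c h|h].
  rewrite dot_sumr -[c]mulr1 -a1 mulr_sumr; apply: ler_sum => i _.
  by rewrite dotZr mulrC ler_wpM2l //; apply/h/pX.
pose l (y : V) := row_mx y (1%:M : 'rV[R]_1).
have [/in_cone_nth[c c0]|[d]] := farkas (map l xs) (l x).
  rewrite size_map => e; exists (size xs), (fun i => xs`_i), (fun i => c i).
  have el (i : 'I_(size xs)) : (map l xs)`_i = l xs`_i by rewrite (nth_map 0).
  split=> [i|//||]; first exact/mem_nth.
  - have := congr1 (@rsubmx _ _ _ _) e; rewrite row_mxKr raddf_sum /=.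
    move/(congr1 (fun A : 'M_1 => A 0 0)); rewrite summxE !mxE eqxx => /esym e1; apply: etrans e1.
    by apply: eq_bigr => i _; rewrite el linearZ /= row_mxKr !mxE eqxx mulr1.
  - have := congr1 (@lsubmx _ _ _ _) e; rewrite row_mxKl raddf_sum => -> /=.
    by apply: eq_bigr => i _; rewrite el linearZ /= row_mxKl.
rewrite -[d]hsubmxK dot_row_mx => -[hd]; rewrite ltNge => /negP[].
rewrite -lerBlDr sub0r (dotC x); apply: h => p /(map_f l)/hd.
by rewrite dot_row_mx -lerBlDr sub0r (dotC p).
Qed.

Lemma polytopeP P : polytope P -> exists2 xs, xs != [::] & P = conv [set` xs].
Proof.
case=> X [/finite_seqP[xs ->] [x xX] ->]; exists xs => //.
by apply/eqP => e; move: xX; rewrite e.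
Qed.

Lemma polytope_conv xs : xs != [::] -> polytope (conv [set` xs]).
Proof.
case: xs => // x xs _; exists [set` x :: xs]; split=> //.
by exists x; exact: mem_head.
Qed.

Lemma sub_conv xs p : p \in xs -> conv [set` xs] p.
Proof. by move=> pxs; apply/convP => g c; exact. Qed.

Lemma suppE P g x : P x -> (forall y, P y -> dot g x <= dot g y) ->
  supp P g = dot g x.
Proof.
move=> Px h; apply/eqP; rewrite eq_le; apply/andP; split.
  apply: ge_inf; last by exists x.
  by exists (dot g x) => _ [y Py <-]; exact: h.
apply: lb_le_inf; first by exists (dot g x), x.
by move=> _ [y Py <-]; exact: h.
Qed.

Lemma supp_conv xs g : xs != [::] ->
  exists2 p, p \in xs & supp (conv [set` xs]) g = dot g p.
Proof.
move=> /(seq_argmin (dot g))[p pxs pm]; exists p => //.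
by apply: suppE => [|y /convP]; [exact: sub_conv | exact].
Qed.

Section Polytope.
Context {P : set V} (polyP : polytope P).

Lemma supp_attained g : exists2 x, P x & dot g x = supp P g.
Proof.
have [xs xs0 ->] := polytopeP polyP.
by have [p pxs ->] := supp_conv g xs0; exists p => //; exact: sub_conv.
Qed.

Lemma supp_le g x : P x -> supp P g <= dot g x.
Proof.
have [xs xs0 ->] := polytopeP polyP => /convP; apply=> p pxs.
have [q qxs qm] := seq_argmin (dot g) xs0.
rewrite (@suppE _ g q) ?qm //; first exact: sub_conv.
by move=> y /convP; apply.
Qed.

Lemma face_inP g x y : face_in P g x -> P y -> dot g x <= dot g y.
Proof. by case=> _ ->; exact: supp_le. Qed.

Lemma face_in_min g x : P x -> (forall y, P y -> dot g x <= dot g y) -> face_in P g x.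
Proof. by move=> Px h; split=> //; rewrite (suppE Px h). Qed.

Lemma face_in_neq0 g : face_in P g !=set0.
Proof. by have [x] := supp_attained g; exists x. Qed.

End Polytope.
End ConvexHull.

(** * Faces, vertices and truncations of polytopes *)

Section Faces.
Context {R : realType} {n : nat}.
Local Notation V := 'rV[R]_n.
Implicit Types (u v x y g a b : V) (P Q F G : set V) (xs : seq V).

(** If [c <= dot h p] at the generators minimizing [g], then adding a large multiple of [g] to [h]
    gives an inequality valid at all generators; on the face the added term is constant and
    cancels. *)
Lemma face_conv xs g : xs != [::] ->
  let ys := [seq p <- xs | dot g p == supp (conv [set` xs]) g] in
  ys != [::] /\ face_in (conv [set` xs]) g = conv [set` ys].
Proof.
move=> xs0 ys; set P := conv _; have pP : polytope P := polytope_conv xs0.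
have [q qxs qm] := supp_conv g xs0.
have qys : q \in ys by rewrite mem_filter -qm eqxx.
have ys0 : ys != [::] by apply/eqP => e; move: qys; rewrite e.
split=> //; apply/seteqP; split=> x.
  move=> [/convP Px gx]; apply/convP => h c hc.
  have [p|p pxs|L L0 hL] := @big_multiplier _ _ xs (fun p => dot h p - c)
      (fun p => dot g p - supp P g).
  - by move=> /sub_conv/(supp_le pP g); rewrite subr_ge0.
  - by move/eqP; rewrite subr_eq0 => pm; rewrite subr_ge0 hc // mem_filter pm.
  have {}hL p : p \in xs -> c + L * supp P g <= dot (h + L *: g) p.
    by move=> pxs; rewrite !dotE; have := hL _ (lexx L) p pxs; lra.
  by have := Px _ _ hL; rewrite !dotE gx lerD2r.
move=> /convP cx; have Px : P x.
  by apply/convP => h c hc; apply: cx => p; rewrite mem_filter => /andP[_ /hc].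
split=> //; apply/eqP; rewrite eq_le (supp_le pP) // andbT -lerN2 -dotNl.
by apply: cx => p; rewrite mem_filter dotNl => /andP[/eqP->].
Qed.

Lemma polytope_face P g : polytope P -> polytope (face_in P g).
Proof.
move=> /polytopeP[xs xs0 ->]; have [ys0 ->] := face_conv g xs0.
exact: polytope_conv.
Qed.

(** Lexicographic minimization, first by [a] and then by [b], is minimization of one form in which
    [a] has a large weight. *)
Lemma face_in_face P a b : polytope P ->
  exists l, face_in P (l *: a + b) = face_in (face_in P a) b.
Proof.
move=> pP; have [xs xs0 eP] := polytopeP pP; pose F := face_in P a.
have pF : polytope F := polytope_face a pP.
have [p|p pxs k0|L L0 hL] := @big_multiplier _ _ xs (fun p => dot b p - supp F b)
      (fun p => dot a p - supp P a).
- by rewrite subr_ge0 => pxs; apply: supp_le => //; rewrite eP; exact: sub_conv.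
- rewrite subr_ge0; apply: supp_le => //; split; last by apply/eqP; rewrite -subr_eq0 k0.
  by rewrite eP; exact: sub_conv.
have {}hL x : P x -> supp F b + L * supp P a <= dot b x + L * dot a x.
  rewrite {1}eP => /convP/(_ (b + L *: a)); rewrite !dotE; apply=> p pxs.
  by rewrite !dotE; have := hL _ (lexx L) p pxs; lra.
(* With weight [L] the form is only bounded below by its value at [y]; the additional 1 forces every
   minimizer to minimize [a] exactly. *)
exists (L + 1); have [y [Py ay] byF] := supp_attained pF b.
have e : supp P ((L + 1) *: a + b) = (L + 1) * supp P a + supp F b.
  rewrite (@suppE _ _ P _ y) //; first by rewrite !dotE ay byF.
  move=> x Px; rewrite !dotE ay byF.
  by have := hL x Px; have := supp_le pP a Px; lra.
apply/seteqP; split=> x; last by case=> -[Px ax] bx; split=> //; rewrite e !dotE ax bx.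
case=> Px; rewrite e !dotE => ex; have h := hL x Px; have h' := supp_le pP a Px.
by have ax : dot a x = supp P a; [lra | split=> //; rewrite -/F; move: ex; rewrite ax; lra].
Qed.

Lemma is_face_trans P F G : polytope P -> is_face P F -> is_face F G -> is_face P G.
Proof.
by move=> pP [a ->] [b ->]; have [l <-] := face_in_face a b pP; exists (l *: a + b).
Qed.

Lemma is_face_polytope P F : polytope P -> is_face P F -> polytope F.
Proof. by move=> pP [a ->]; exact: polytope_face. Qed.

Lemma is_face_sub P F : is_face P F -> F `<=` P.
Proof. by case=> a -> x []. Qed.

Lemma vertex_in P v : vertex P v -> P v.
Proof. by move=> /is_face_sub; exact. Qed.

Lemma face_in0 P : polytope P -> face_in P 0 = P.
Proof.
move=> pP; apply/seteqP; split=> x; first by case.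
by move=> Px; apply: face_in_min => // y _; rewrite !dot0l.
Qed.

(** Induction on the number of generators: for distinct generators [p] and [q], the form [p - q]
    takes different values at them, so the face it selects loses one of the two. *)
Lemma polytope_vertex P : polytope P -> exists v, vertex P v.
Proof.
move=> pP; have [xs] := polytopeP pP.
elim: {xs}(size xs) {-2}xs (leqnn (size xs)) P pP => [|k IH] xs sz P pP xs0 eP.
  by move: xs0; rewrite -size_eq0 -leqn0 sz.
case: xs sz xs0 eP => // p xs sz xs0 eP.
have pxs : p \in p :: xs := mem_head p xs.
have [/allP h|/allPn[q qxs qp]] := boolP (all (pred1 p) (p :: xs)).
  exists p; exists 0; rewrite face_in0 //; apply/seteqP; split=> x; last first.
    rewrite eP => /convP cx; apply/eqP; rewrite -subr_eq0 -dot_eq0 eq_le.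
    rewrite {2}dotBr subr_ge0 cx => [|q /h/eqP-> //]; rewrite andbT.
    rewrite dotBr subr_le0 -lerN2 -!dotNl.
    by rewrite cx // => q /h/eqP->.
  by move=> ->; rewrite eP; exact: sub_conv.
set m := supp (conv [set` p :: xs]) (p - q).
pose ys := [seq z <- p :: xs | dot (p - q) z == m].
have [ys0 e] : ys != [::] /\ face_in (conv [set` p :: xs]) (p - q) = conv [set` ys] :=
  face_conv (p - q) xs0.
have pF := polytope_face (p - q) pP.
have [||v [w vw]] := IH ys _ _ pF ys0.
- rewrite -ltnS; apply: leq_trans sz; rewrite /ys size_filter -(count_predC (fun z => dot (p - q) z == m)).
  rewrite -[X in (X < _)%N]addn0 ltn_add2l -has_count; apply/hasP.
  have [pm|pm] := eqVneq (dot (p - q) p) m.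
    exists q => //=; rewrite -pm -subr_eq0 -dotBr -[q - p]opprB dotNr oppr_eq0.
    by rewrite dot_eq0 subr_eq0 eq_sym.
  by exists p.
- by rewrite {1}eP.
by exists v; apply: is_face_trans (pP) _ _; [exists (p - q) | exists w].
Qed.

Lemma face_vertex P F v : polytope P -> is_face P F -> vertex F v -> vertex P v.
Proof. by move=> pP fF; exact: is_face_trans. Qed.

Lemma vertex_face P F v : polytope P -> is_face P F -> vertex P v -> F v -> vertex F v.
Proof.
move=> pP fF [a va] Fv; exists a; apply/seteqP; split=> x.
  move=> ->; apply: face_in_min => // y Fy; apply: (face_inP pP); last exact: is_face_sub Fy.
  by rewrite -va.
move=> xF; rewrite va; have av : face_in P a v by rewrite -va.
apply: face_in_min; first by apply: (is_face_sub fF); case: xF.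
move=> y Py; apply: le_trans (face_inP pP av Py).
exact: (face_inP (is_face_polytope pP fF) xF).
Qed.

Lemma face_has_vertex P F : polytope P -> is_face P F -> exists2 v, vertex P v & F v.
Proof.
move=> pP fF; have [v vF] := polytope_vertex (is_face_polytope pP fF).
by exists v; [exact: face_vertex vF | exact: vertex_in vF].
Qed.

Lemma supp_vertex P g : polytope P -> exists2 v, vertex P v & face_in P g v.
Proof. by move=> pP; apply: face_has_vertex => //; exists g. Qed.

Lemma vertex_le P g (c : R) x : polytope P ->
  (forall v, vertex P v -> c <= dot g v) -> P x -> c <= dot g x.
Proof.
move=> pP h Px; have [v /h cv vF] := supp_vertex g pP.
exact: le_trans cv (face_inP pP vF Px).
Qed.

Lemma vertices_finite P : polytope P ->
  exists2 vs : seq V, vs != [::] & [set v | vertex P v] = [set` vs].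
Proof.
move=> pP; have [xs xs0 eP] := polytopeP pP.
have vxs v : vertex P v -> v \in xs.
  case=> a; rewrite eP; have [ys0 ->] := face_conv a xs0.
  case eys: [seq _ <- _ | _] ys0 => [//|p ys] _ e.
  have : [set v] p by rewrite e; exact/sub_conv/mem_head.
  move=> <-; have := mem_head p ys; rewrite -eys mem_filter.
  by case/andP.
exists [seq v <- xs | `[< vertex P v >]].
  have [v vP] := polytope_vertex pP.
  have: v \in [seq v <- xs | `[< vertex P v >]].
    by rewrite mem_filter vxs // andbT; exact/asboolP.
  by apply: contraTneq => ->.
apply/seteqP; split=> v /=; last by rewrite mem_filter => /andP[/asboolP].
by move=> vP; rewrite mem_filter vxs // andbT; exact/asboolP.
Qed.

(** The new generators are the old ones on the kept side and the points where segments from a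
    removed to a kept generator cross the cutting hyperplane. *)
Lemma truncation_convE P u (e : R) xs : P = conv [set` xs] ->
  let c := supp P u + e in
  let cut (p q : V) := (dot u q - dot u p)^-1 *:
    ((dot u q - c) *: p + (c - dot u p) *: q) in
  truncation P u e = conv [set` [seq p <- xs | c <= dot u p] ++
    [seq cut p q | p <- [seq p <- xs | dot u p < c],
                   q <- [seq q <- xs | c < dot u q]]].
Proof.
move=> eP c cut; set lo := [seq p <- xs | dot u p < c].
set hi := [seq q <- xs | c < dot u q]; set Y := _ ++ _.
have cutE g p q : p \in lo -> q \in hi -> dot g (cut p q) =
    ((dot u q - c) * dot g p + (c - dot u p) * dot g q) / (dot u q - dot u p).
  by move=> _ _; rewrite !dotE mulrC.
apply/seteqP; split=> x.
  rewrite /truncation /= -/c {1}eP => -[/convP Px ux]; apply/convP => g m hg.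
  have hi_g q : q \in xs -> c <= dot u q -> m <= dot g q.
    by move=> qxs cq; apply: hg; rewrite mem_cat mem_filter qxs cq.
  (* A Lagrange multiplier for the cut. It is dictated by the removed generator [p0] of least ratio;
     at a generator beyond the cut, validity follows from the crossing point on its segment to
     [p0]. *)
  have [l l0 hl] : exists2 l, 0 <= l &
      forall p, p \in xs -> m - l * c <= dot (g - l *: u) p.
    have [lo0|lo0] := eqVneq lo [::].
      exists 0 => // p pxs; rewrite mul0r scale0r !subr0 hi_g // leNgt; apply/negP => pc.
      by have : p \in lo; [rewrite mem_filter pc | rewrite lo0].
    have [p0 p0lo p0m] := seq_argmin (fun p => (dot g p - m) / (c - dot u p)) lo0.
    set r := (dot g p0 - m) / _ in p0m.
    have lor p : p \in lo -> r * (c - dot u p) <= dot g p - m.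
      move=> plo; have := p0m p plo; rewrite ler_pdivlMr // subr_gt0.
      by move: plo; rewrite mem_filter => /andP[].
    exists (Num.max 0 (- r)); first by rewrite le_max lexx.
    move=> p pxs; rewrite !dotE; have [pc|pc] := ltP (dot u p) c.
      have := lor p; rewrite mem_filter pc => /(_ pxs) h.
      have h' : - r <= Num.max 0 (- r) by rewrite le_max lexx orbT.
      have : - r * (c - dot u p) <= Num.max 0 (- r) * (c - dot u p).
        by apply: ler_wpM2r => //; rewrite subr_ge0 ltW.
      lra.
    have hp := hi_g p pxs pc.
    have [r0|r0] := leP 0 (- r); last by rewrite !mul0r !subr0.
    move: pc; rewrite le_eqVlt => /predU1P[<-|pc]; first lra.
    have phi : p \in hi by rewrite mem_filter pc.
    have p0c : dot u p0 < c by move: p0lo; rewrite mem_filter => /andP[].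
    have : m <= dot g (cut p0 p) by apply: hg; rewrite mem_cat allpairs_f ?orbT.
    rewrite cutE // ler_pdivlMr ?subr_gt0 ?(lt_trans p0c) // => h.
    have er : r * (c - dot u p0) = dot g p0 - m by rewrite divfK // subr_eq0 gt_eqF.
    have : 0 <= (c - dot u p0) * ((dot u p - c) * r + (dot g p - m)).
      have -> : (c - dot u p0) * ((dot u p - c) * r + (dot g p - m)) = (dot u p - c) * (r * (c - dot u p0)) + (c - dot u p0) * (dot g p - m) by ring.
      by rewrite er; lra.
    rewrite pmulr_rge0 ?subr_gt0 // => h2; lra.
  have := Px _ _ hl; rewrite !dotE => h.
  have : l * c <= l * dot u x by apply: ler_wpM2l.
  lra.
have cond g (m : R) : (forall p, p \in xs -> m <= dot g p) -> forall p, p \in Y -> m <= dot g p.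
  move=> h p; rewrite mem_cat mem_filter => /orP[/andP[_ /h//]|/allpairsP[[a b] /= [alo bhi ->]]].
  rewrite cutE //; move: alo bhi; rewrite !mem_filter => /andP[ac /h ha] /andP[bc /h hb].
  rewrite ler_pdivlMr ?subr_gt0 ?(lt_trans ac) //.
  have -> : m * (dot u b - dot u a) = (dot u b - c) * m + (c - dot u a) * m by ring.
  by rewrite lerD // ler_wpM2l // subr_ge0 ltW.
move=> /convP cx; split; first by rewrite eP; apply/convP => g m h; apply: cx; exact: cond.
apply: cx => p; rewrite mem_cat mem_filter => /orP[/andP[]//|/allpairsP[[a b] /= [alo bhi ->]]].
rewrite cutE //; move: alo bhi; rewrite !mem_filter => /andP[ac _] /andP[bc _].
rewrite ler_pdivlMr ?subr_gt0 ?(lt_trans ac) //.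
by rewrite -/c le_eqVlt; apply/orP; left; apply/eqP; ring.
Qed.

Lemma polytope_truncation P u (e : R) :
  polytope P -> truncation P u e !=set0 -> polytope (truncation P u e).
Proof.
move=> /polytopeP[xs _ eP]; rewrite (truncation_convE u e eP) => ne.
(* With no generators every inequality is vacuously valid, even [1 <= dot 0 x]. *)
apply: polytope_conv; apply: contraPneq ne => -> [x /convP h].
by have : (1 : R) <= dot 0 x by [apply: h]; rewrite dot0l ler10.
Qed.

(** With the converse [face_in_sub_supp], this expresses inclusion of faces by values of the support
    function, so that it can be transferred to other polytopes. Generators off [face_in P u] exceed
    the minimum of [u] by a positive amount, which a small multiple of [u'] cannot offset. *)
Lemma supp_subZ P u u' : polytope P -> face_in P u `<=` face_in P u' ->
  exists2 t0 : R, 0 < t0 & forall t, 0 < t -> t <= t0 ->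
    supp P (u - t *: u') = supp P u - t * supp P u'.
Proof.
move=> pP uu'; have [xs xs0 eP] := polytopeP pP.
have [p|p pxs /eqP p0|L L0 hL] := @big_multiplier _ _ xs (fun p => supp P u' - dot u' p)
    (fun p => dot u p - supp P u).
- by rewrite subr_ge0 => pxs; apply: supp_le => //; rewrite eP; exact: sub_conv.
- have [|_ ->] := uu' p; last by rewrite subrr.
  by split; [rewrite eP; exact: sub_conv | apply/eqP; rewrite -subr_eq0 p0].
have [z Pz uz] := supp_attained pP u; have [_ u'z] := uu' z (conj Pz uz).
exists L^-1 => [|t t0 tL]; first by rewrite invr_gt0.
rewrite (suppE Pz) => [|y]; first by rewrite !dotE uz u'z.
rewrite {1}eP => /convP; apply=> p pxs.
have Lt : L <= t^-1 by rewrite -[L]invrK lef_pV2 ?posrE ?invr_gt0.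
have := hL _ Lt p pxs; rewrite mulrC !dotE uz u'z => h.
have : 0 <= t * (supp P u' - dot u' p + (dot u p - supp P u) / t) by rewrite mulr_ge0 // ltW.
rewrite mulrDr mulrCA divff ?gt_eqF // mulr1; lra.
Qed.

Lemma face_in_sub_supp P u u' (t : R) : polytope P -> 0 < t ->
  supp P (u - t *: u') = supp P u - t * supp P u' -> face_in P u `<=` face_in P u'.
Proof.
move=> pP t0 e x [Px ux]; split=> //; apply/eqP; rewrite eq_le supp_le // andbT.
have := supp_le pP (u - t *: u') Px; rewrite e !dotE ux lerD2l lerN2.
by rewrite ler_pM2l.
Qed.

End Faces.

(** * Edges, improving edges and the depth of a face *)

Section Edges.
Context {R : realType} {n : nat}.
Local Notation V := 'rV[R]_n.
Implicit Types (u v x y z g a b : V) (P Q F G : set V) (xs : seq V).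

Lemma vertex_lt P a z x : polytope P -> [set z] = face_in P a -> P x -> x != z ->
  0 < dot a (x - z).
Proof.
move=> pP ea Px xz; have az : face_in P a z by rewrite -ea.
rewrite dotBr subr_gt0 lt_neqAle (face_inP pP az Px) andbT.
apply: contra xz => /eqP e; apply/eqP.
suff : [set z] x by [].
by rewrite ea; split=> //; rewrite -e; case: az.
Qed.

(* Maximizing the slope of [b] against [a] over the edges leaving [z] exposes a
   face of [P] at [z]. *)
Lemma max_slope_face P a b z x0 : polytope P -> [set z] = face_in P a ->
  P x0 -> x0 != z ->
  exists r, [/\ face_in P (r *: a - b) z,
    exists2 x, face_in P (r *: a - b) x & x != z &
    forall x, P x -> dot b (x - z) <= r * dot a (x - z)].
Proof.
move=> pP ea Px0 x0z; have [xs xs0 eP] := polytopeP pP.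
have Pz : P z by have : [set z] z by []; rewrite ea => -[].
have xsP p : p \in xs -> P p by rewrite eP; exact: sub_conv.
pose ys := [seq p <- xs | p != z].
have ys0 : ys != [::].
  apply: contra x0z => /eqP ys0; rewrite -subr_eq0 -dot_eq0; apply/eqP.
  have h p : p \in xs -> p = z.
    move=> pxs; apply/eqP; rewrite -[_ == _]negbK; apply/negP => pz.
    by have : p \in ys; [rewrite mem_filter pz | rewrite ys0].
  move: Px0; rewrite eP => /convP cx; apply/eqP; rewrite eq_le; apply/andP; split.
    rewrite dotBr subr_le0 -lerN2 -!dotNl.
    by apply: cx => p /h->.
  by rewrite dotBr subr_ge0; apply: cx => p /h->.
have [p pys pm] := seq_argmin (fun p => - (dot b (p - z) / dot a (p - z))) ys0.
move: pys; rewrite mem_filter => /andP[pz pxs].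
set r := dot b (p - z) / dot a (p - z) in pm.
have hr x : P x -> dot b (x - z) <= r * dot a (x - z).
  have h q : q \in xs -> dot (r *: a - b) z <= dot (r *: a - b) q.
    move=> qxs; have [->//|qz] := eqVneq q z.
    have := pm q; rewrite mem_filter qz qxs => /(_ isT); rewrite lerN2.
    rewrite ler_pdivrMr; last exact: (vertex_lt pP ea (xsP _ qxs)).
    rewrite !dotE; lra.
  by rewrite {1}eP => /convP/(_ _ _ h); rewrite !dotE; lra.
have zF : face_in P (r *: a - b) z.
  by apply: face_in_min => // y /hr; rewrite !dotE; lra.
exists r; split=> //; exists p => //; split; first exact: xsP.
have [_ <-] := zF; have : r * dot a (p - z) = dot b (p - z).
  by rewrite divfK // gt_eqF // (vertex_lt pP ea) //; exact: xsP.
rewrite !dotE; lra.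
Qed.

Lemma has_dim1 F z p : F z -> F p -> p != z ->
  (forall x, F x -> exists t : R, x - z = t *: (p - z)) -> has_dim F 1.
Proof.
move=> Fz Fp pz h; exists z, (p - z); split=> //.
- by rewrite /row_free rank_rV subr_eq0 pz.
- by move=> i; rewrite row_id addrC subrK.
- by move=> x /h/sub_rVP.
Qed.

(** Induction on the number of generators. Let [w q] be the projection of [q - z] along [p - z] to
    the hyperplane orthogonal to [a]. If all [w q] vanish, [P] lies on a line and is the edge;
    otherwise the face of maximal slope of some nonzero [w q] contains [z] and another point, but
    not [p]. *)
Lemma edge_at_vertex P z x0 : polytope P -> vertex P z -> P x0 -> x0 != z ->
  exists E, [/\ edge P E, E z & exists2 x, E x & x != z].
Proof.
move=> pP; have [xs] := polytopeP pP.
elim: {xs}(size xs) {-2}xs (leqnn (size xs)) P x0 pP => [|k IH] xs sz P x0 pP xs0 eP.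
  by move: xs0; rewrite -size_eq0 -leqn0 sz.
move=> vz Px0 x0z; have [a ea] := vz.
have xsP p : p \in xs -> P p by rewrite eP; exact: sub_conv.
have Pz := vertex_in vz.
have [p pxs pz] : exists2 p, p \in xs & p != z.
  have [/allP h|/allPn[p pxs pz]] := boolP (all (pred1 z) xs); last by exists p.
  move: (vertex_lt pP ea Px0 x0z); rewrite dotBr subr_gt0 ltNge => /negP[].
  move: Px0; rewrite eP => /convP/(_ (- a) (- dot a z)); rewrite dotNl lerN2; apply.
  by move=> q /h/eqP->; rewrite dotNl.
have ap : 0 < dot a (p - z) by apply: (vertex_lt pP ea) => //; exact: xsP.
pose w q := (q - z) - (dot a (q - z) / dot a (p - z)) *: (p - z).
have [/allP h|/allPn[q qxs wq]] := boolP (all (fun q => w q == 0) xs).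
  exists P; split=> //; last by exists p => //; exact: xsP.
  split; first by exists 0; rewrite face_in0.
  apply: (has_dim1 Pz (xsP _ pxs) pz) => x; rewrite {1}eP => /convP cx.
  exists (dot a (x - z) / dot a (p - z)); apply/eqP; rewrite -subr_eq0 -dot_eq0 -/(w x).
  (* [g] is orthogonal to [p - z], hence constant on the generators and equal at [x] and [z]; as [a]
     is orthogonal to [w x], its value on [w x] is the squared norm of [w x]. *)
  pose g := w x - (dot (w x) (p - z) / dot a (p - z)) *: a.
  have gq q : q \in xs -> dot g q = dot g z.
    move=> /h/eqP wq; apply/eqP; rewrite -subr_eq0 -dotBr; apply/eqP.
    transitivity (dot (w x) (w q)); last by rewrite wq dot0r.
    by rewrite /g; move: (w x) => W; rewrite /w !(dotBl, dotBr, dotZr, dotZl); ring.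
  have : dot g x = dot g z.
    apply/eqP; rewrite eq_le; apply/andP; split; last by apply: cx => q /gq->.
    by rewrite -lerN2 -!dotNl; apply: cx => q /gq; rewrite !dotNl => ->.
  move/eqP; rewrite -subr_eq0 -dotBr => /eqP gx; apply/eqP.
  rewrite -[RHS]gx /g [X in dot _ X]/w; move: (w x) => W; rewrite !(dotBl, dotBr, dotZr, dotZl); ring.
have aq : 0 < dot a (q - z).
  apply: (vertex_lt pP ea); first exact: xsP.
  by apply: contra wq => /eqP->; rewrite /w subrr dot0r mul0r scale0r subr0.
have [r [zF [x xF xz] hr]] := max_slope_face (w q) pP ea Px0 x0z.
(* If [p] had the maximal slope [r], the positive squared norm of [w q] would give [q] a slope above
   [r]. *)
have pF : ~ face_in P (r *: a - w q) p.
  have hq := hr _ (xsP _ qxs); have hp := hr _ (xsP _ pxs).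
  case=> _ ep; have ez := zF.2.
  have wq0 : 0 < dot (w q) (q - z) - dot a (q - z) / dot a (p - z) * dot (w q) (p - z).
    by rewrite -dotZr -dotBr; exact: dot_gt0.
  have : dot (w q) (p - z) = r * dot a (p - z).
    by move: ep; rewrite -ez !dotE; lra.
  move=> e; move: wq0; rewrite e mulrCA divfK ?gt_eqF // subr_gt0 ltNge.
  by rewrite hq.
pose F := face_in P (r *: a - w q).
have fF : is_face P F by exists (r *: a - w q).
pose ys := [seq x <- xs | dot (r *: a - w q) x == supp (conv [set` xs]) (r *: a - w q)].
have [ys0 e] : ys != [::] /\ face_in (conv [set` xs]) (r *: a - w q) = conv [set` ys] :=
  face_conv _ xs0.
have [||||E [[fE dE] Ez Ex]] := IH ys _ F x _ ys0 _ _ xF xz.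
- rewrite -ltnS; apply: leq_trans sz; rewrite /ys size_filter.
  rewrite -(count_predC (fun x => dot (r *: a - w q) x == supp (conv [set` xs]) (r *: a - w q))).
  rewrite -[X in (X < _)%N]addn0 ltn_add2l -has_count; apply/hasP; exists p => //=.
  by apply/negP => /eqP ep; apply: pF; split; [exact: xsP | rewrite {1}eP].
- exact: polytope_face.
- by rewrite -e -eP.
- exact: (vertex_face pP fF vz zF).
by exists E; split=> //; split=> //; exact: (is_face_trans pP fF fE).
Qed.

(** The pivot step of the simplex method. On the face at [z] of maximal slope of [- u] against [a],
    this slope is a positive constant, so [u] decreases along every edge of that face leaving
    [z]. *)
Lemma improving_edge P z u : polytope P -> vertex P z -> supp P u < dot u z ->
  exists E v, [/\ edge P E, E z, E v, vertex P v & dot u v < dot u z].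
Proof.
move=> pP vz uz; have [a ea] := vz.
have [x0 Px0 ux0] := supp_attained pP u.
have x0z : x0 != z by apply: contraTneq uz => <-; rewrite ux0 ltxx.
have [r [zF [x xF xz] hr]] := max_slope_face (- u) pP ea Px0 x0z.
set g := r *: a - - u in zF xF.
have fF : is_face P (face_in P g) by exists g.
have r0 : 0 < r.
  have := hr _ Px0; rewrite dotNl dotBr ux0 => h.
  have ax := vertex_lt pP ea Px0 x0z.
  by rewrite -(pmulr_lgt0 _ ax); lra.
have pF := is_face_polytope pP fF.
have [E [[fE dE] Ez [y Ey yz]]] := edge_at_vertex pF (vertex_face pP fF vz zF) xF xz.
have fPE := is_face_trans pP fF fE.
have [v vE vm] := supp_vertex u (is_face_polytope pP fPE).
exists E, v; split=> //; [exact: vertex_in vE | exact: face_vertex vE|].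
apply: le_lt_trans (face_inP (is_face_polytope pP fPE) vm Ey) _.
have [Py gy] := is_face_sub fE Ey; have gz := zF.2.
have ay := vertex_lt pP ea Py yz.
have : 0 < r * dot a (y - z) by rewrite mulr_gt0.
by move: gy; rewrite -gz /g !dotE; lra.
Qed.

(** The depth only looks at neighbors of the face. But a vertex [w] off the face with least
    [dot u w] is one: its improving edge leads to a lower vertex, which must be in the face. *)
Lemma depth_le_vertex P u v : polytope P -> vertex P v -> ~ face_in P u v ->
  depth P (face_in P u) u <= dot u v - supp P u.
Proof.
move=> pP vP vF; have [vs vs0 evs] := vertices_finite pP.
have vsP w : w \in vs <-> vertex P w by rewrite -[vertex P w]/([set w | vertex P w] w) evs.
pose ws := [seq w <- vs | `[< ~ face_in P u w >]].
have vws : v \in ws by rewrite mem_filter; apply/andP; split; [exact/asboolP|exact/vsP].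
have ws0 : ws != [::] by apply: contraTneq vws => ->.
have [w wws wm] := seq_argmin (dot u) ws0.
move: wws; rewrite mem_filter => /andP[/asboolP wF /vsP wP].
apply: le_trans (_ : dot u w - supp P u <= _); last by rewrite lerD2r wm.
have uw : supp P u < dot u w.
  rewrite lt_neqAle (supp_le pP _ (vertex_in wP)) andbT; apply/negP => /eqP e.
  by apply: wF; split; [exact: vertex_in|].
have [E [y [eE Ew Ey yP yw]]] := improving_edge pP wP uw.
apply: ge_inf; first by exists 0 => _ [x [xP _ _] <-]; rewrite subr_ge0 supp_le //; exact: vertex_in.
exists w => //; split=> //; exists y, E; split=> //.
apply: contrapT => yF; have : y \in ws by rewrite mem_filter; apply/andP; split; [exact/asboolP|exact/vsP].
by move/wm; rewrite leNgt yw.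
Qed.

(** A face with a point less than the depth above the minimum of [u] has a vertex that low, and such
    a vertex lies on [face_in P u]. This is what allows a shallow cut to be undone. *)
Lemma shallow_meets_face P u g x (e : R) : polytope P -> e < depth P (face_in P u) u ->
  face_in P g x -> dot u x <= supp P u + e ->
  exists2 y, face_in P g y & face_in P u y.
Proof.
move=> pP ed xg ux; have fF : is_face P (face_in P g) by exists g.
have pF := is_face_polytope pP fF.
have [v vF vm] := supp_vertex u pF.
exists v; first exact: vertex_in vF.
apply: contrapT => vu; have := depth_le_vertex pP (face_vertex pP fF vF) vu.
by have := face_inP pF vm xg; lra.
Qed.

End Edges.

(** * Normal fans, piecewise linear functions and Minkowski sums *)

Section Fans.
Context {R : realType} {n : nat}.
Local Notation V := 'rV[R]_n.
Implicit Types (u v x y z g a b : V) (P Q F G : set V) (B : set (set V)).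

(** Otherwise Farkas' lemma gives a direction [d] that decreases [u] and violates no active
    constraint; a step of length [L^-1] respects the inactive ones too, so [x] was not a
    minimizer. *)
Lemma farkas_active (T : choiceType) (s : seq T) (U : T -> V) (c : T -> R) P u x :
  uniq s -> polytope P -> P = [set y | forall i, i \in s -> c i <= dot (U i) y] ->
  face_in P u x ->
  exists2 l : T -> R, forall i, 0 <= l i &
    u = \sum_(i <- s | dot (U i) x == c i) l i *: U i.
Proof.
move=> us pP eP xu; have Px := xu.1.
have [|[d [hd ud]]] := farkas (map U [seq i <- s | dot (U i) x == c i]) u.
  move=> /in_cone_uniq -/(_ (filter_uniq _ us))[l l0 ->].
  by exists l => //; rewrite big_filter.
have [i si|i si /eqP|L L0 hL] :=
  @big_multiplier _ _ s (fun i => dot (U i) d) (fun i => dot (U i) x - c i).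
- by rewrite subr_ge0; move: Px; rewrite eP; apply.
- by rewrite subr_eq0 => ci; apply/hd/map_f; rewrite mem_filter ci.
have Py : P (x + L^-1 *: d).
  rewrite eP => i si; rewrite dotDr dotZr -subr_ge0.
  have : 0 <= L^-1 * (dot (U i) d + L * (dot (U i) x - c i)).
    by rewrite mulr_ge0 ?hL // invr_ge0 ltW.
  by rewrite mulrDr mulrA mulVf ?gt_eqF // mul1r; lra.
have := face_inP pP xu Py; rewrite dotDr dotZr lerDl pmulr_rge0 ?invr_gt0 //.
by rewrite leNgt ud.
Qed.

Lemma normal_cone_face P u u' : polytope P ->
  normal_cone P (face_in P u) u' <-> face_in P u `<=` face_in P u'.
Proof.
move=> pP; split=> [h x xu|h x /h[]//].
by split; [case: xu | exact: h].
Qed.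

(** On the normal cone of a face containing [x], the point [y] minimizes every direction over [Q],
    so [supp Q] is the linear form of [y] there. *)
Lemma PL_cover P Q : polytope P -> polytope Q ->
  (forall x, P x -> exists2 y, Q y & forall u, face_in P u x -> face_in Q u y) ->
  PL (normal_fan P) (supp Q).
Proof.
move=> pP pQ h C [F [fF [x Fx]] <-]; have Px := is_face_sub fF Fx.
have [y Qy hy] := h x Px; exists y => u /(_ x Fx) ux.
by rewrite dotC; have [_ ->] := hy u (conj Px ux).
Qed.

(** The normal cone of [face_in P u] contains [u], [u'] and, by [supp_subZ], also [u - t *: u'] for
    small [t]; on it [f] is linear. *)
Lemma PL_face_in P (f : V -> R) u u' : polytope P -> PL (normal_fan P) f ->
  face_in P u `<=` face_in P u' ->
  exists2 t0 : R, 0 < t0 & forall t, 0 < t -> t <= t0 ->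
    f (u - t *: u') = f u - t * f u'.
Proof.
move=> pP fP uu'; have [t0 t00 ht] := supp_subZ pP uu'.
have [|a fa] := fP (normal_cone P (face_in P u)).
  by exists (face_in P u) => //; split; [exists u | exact: face_in_neq0].
exists t0 => // t tp tt0; rewrite (fa u) => [|x []//].
rewrite (fa u') => [|x /uu'[]//]; rewrite fa ?dotBr ?dotZr //.
by move=> x xu; rewrite ht // dotBl dotZl xu.2 (uu' _ xu).2.
Qed.

Lemma PL_face_sub P Q u u' : polytope P -> polytope Q -> PL (normal_fan P) (supp Q) ->
  face_in P u `<=` face_in P u' -> face_in Q u `<=` face_in Q u'.
Proof.
move=> pP pQ QP /(PL_face_in pP QP)[t t0 ht].
exact: (face_in_sub_supp pQ t0 (ht _ t0 (lexx _))).
Qed.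

Lemma coarsens_PL P Q : polytope P -> polytope Q -> PL (normal_fan P) (supp Q) ->
  coarsens (normal_fan Q) (normal_fan P).
Proof.
move=> pP pQ QP _ [F [fF F0] <-].
exists [set normal_cone P (face_in P u) | u in normal_cone Q F]; split.
  move=> _ [u _ <-]; exists (face_in P u) => //.
  by split; [exists u | exact: face_in_neq0].
apply/seteqP; split=> [u uF|u [_ [u' u'F <-]] /(normal_cone_face _ _ pP) uu' x Fx].
  by exists (normal_cone P (face_in P u)); [exists u | exact/normal_cone_face].
have := PL_face_sub pP pQ QP uu'; case/(_ x) => //.
by split; [exact: is_face_sub Fx | exact: u'F].
Qed.

(** A normal fan is determined by the inclusions among the faces [face_in P u]. Only nonemptiness of
    these faces is assumed, so that the lemma applies directly to a Minkowski sum. *)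
Lemma eq_normal_fan P Q :
  (forall u, face_in P u !=set0) -> (forall u, face_in Q u !=set0) ->
  (forall u u', face_in P u `<=` face_in P u' <-> face_in Q u `<=` face_in Q u') ->
  normal_fan P = normal_fan Q.
Proof.
move=> P0 Q0 h.
have sub P' Q' : (forall u, face_in Q' u !=set0) ->
    (forall u u', face_in P' u `<=` face_in P' u' <-> face_in Q' u `<=` face_in Q' u') ->
    normal_fan P' `<=` normal_fan Q'.
  move=> Q0' h' _ [_ [[u ->] u0] <-]; exists (face_in Q' u).
    by split; [exists u | exact: Q0'].
  have nE P1 u' : normal_cone P1 (face_in P1 u) u' <-> face_in P1 u `<=` face_in P1 u'.
    by split=> [k x xu|k x /k[]//]; split; [case: xu | exact: k].
  by apply/seteqP; split=> u' /nE/h'/nE.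
apply/seteqP; split; apply: sub => // u u'.
by split=> /h.
Qed.

Section Family.
Context (s : seq (set V)) (us : uniq s) (Q : set V -> set V).
Context (pQ : forall F, F \in s -> polytope (Q F)).
Let M := minkowski_sum [set` s] Q.

Let minz u F : V := xget 0 (face_in (Q F) u).

Let minzP u F : F \in s -> face_in (Q F) u (minz u F).
Proof.
move=> /pQ pF; have [x xF] := face_in_neq0 pF u; exact: (xgetPex 0 (ex_intro _ x xF)).
Qed.

Lemma minkowski_sumP x :
  M x <-> exists2 y : set V -> V, forall F, F \in s -> Q F (y F) & x = \sum_(F <- s) y F.
Proof.
split=> [[y [yQ ->]]|[y yQ ->]]; exists y.
- exact: yQ.
- by rewrite (fsbig_seq _ _ us).
- by split; [exact: yQ | rewrite (fsbig_seq _ _ us)].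
Qed.

Lemma face_minkowski u (y : set V -> V) : (forall F, F \in s -> Q F (y F)) ->
  face_in M u (\sum_(F <- s) y F) <-> forall F, F \in s -> face_in (Q F) u (y F).
Proof.
move=> yQ; have M0 : M (\sum_(F <- s) minz u F).
  by apply/minkowski_sumP; exists (minz u) => // F /(minzP u)[].
have e : supp M u = \sum_(F <- s) supp (Q F) u.
  rewrite (@suppE _ _ M _ _ M0).
    by rewrite dot_sumr; apply: eq_big_seq => F /(minzP u)[].
  move=> x /minkowski_sumP[z zQ ->]; rewrite !dot_sumr.
  rewrite [leLHS]big_seq [leRHS]big_seq; apply: ler_sum => F Fs.
  exact: (face_inP (pQ Fs) (minzP u Fs) (zQ _ Fs)).
have My : M (\sum_(F <- s) y F) by apply/minkowski_sumP; exists y.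
split=> [[_]|h]; last first.
  by split=> //; rewrite e dot_sumr; apply: eq_big_seq => F /h[].
rewrite e dot_sumr => /eqP; rewrite -subr_eq0 -sumrB big_seq psumr_eq0; last first.
  by move=> F Fs; rewrite subr_ge0; apply: supp_le; [exact: pQ | exact: yQ].
move=> /allP h F Fs; split; first exact: yQ.
by apply/eqP; rewrite -subr_eq0; have := h F Fs; rewrite Fs.
Qed.

Lemma face_minkowski_neq0 u : face_in M u !=set0.
Proof.
exists (\sum_(F <- s) minz u F); apply/face_minkowski => F Fs; last exact: minzP.
by case: (minzP u Fs).
Qed.

Lemma face_minkowski_sub u u' : face_in M u `<=` face_in M u' <->
  forall F, F \in s -> face_in (Q F) u `<=` face_in (Q F) u'.
Proof.
split=> [h F Fs x xu|h x xu].
  pose y G := if G == F then x else minz u G.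
  have yQ G : G \in s -> face_in (Q G) u (y G).
    by rewrite /y; case: eqP => [->//|_]; exact: minzP.
  have yQ' G : G \in s -> Q G (y G) by move=> /yQ[].
  have /h/(face_minkowski u' yQ')/(_ F Fs) := (face_minkowski u yQ').2 yQ.
  by rewrite /y eqxx.
have /minkowski_sumP[y yQ ex] := xu.1; rewrite {x}ex in xu *.
by apply/face_minkowski => // F Fs; apply: h => //; exact: ((face_minkowski u yQ).1 xu).
Qed.

(* [supp P] is a combination of the [supp (Q F)], hence linear wherever the
   support function of the Minkowski sum is. *)
Lemma normal_fan_minkowski P (c : set V -> R) : polytope P ->
  (forall F, F \in s -> PL (normal_fan P) (supp (Q F))) ->
  (forall u, supp P u = \sum_(F <- s) c F * supp (Q F) u) ->
  normal_fan M = normal_fan P.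
Proof.
move=> pP QPL hP; apply: eq_normal_fan.
- exact: face_minkowski_neq0.
- exact: face_in_neq0.
move=> u u'; split=> [/face_minkowski_sub h|h]; last first.
  by apply/face_minkowski_sub => F Fs; apply: (PL_face_sub pP (pQ Fs) (QPL _ Fs)).
have [t t0 ht] : exists2 t : R, 0 < t & forall F, F \in s ->
    supp (Q F) (u - t *: u') = supp (Q F) u - t * supp (Q F) u'.
  suff [t t0 ht] : exists2 t : R, 0 < t & forall r, 0 < r -> r <= t -> forall F, F \in s ->
      supp (Q F) (u - r *: u') = supp (Q F) u - r * supp (Q F) u'.
    by exists t => //; exact: ht.
  elim: (s) (pQ) h => [|F r IH] pr h; first by exists 1.
  have [|G Gr|t t0 ht] := IH; [by move=> G Gr; apply: pr; rewrite inE Gr orbT|by apply: h; rewrite inE Gr orbT|].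
  have [t' t'0 ht'] := supp_subZ (pr F (mem_head _ _)) (h F (mem_head _ _)).
  exists (Num.min t t'); first by rewrite lt_min t0.
  move=> q q0; rewrite le_min => /andP[qt qt'] G; rewrite inE => /predU1P[->|Gr].
    exact: ht'.
  exact: ht.
apply: (face_in_sub_supp pP t0); rewrite !hP mulr_sumr -sumrB.
by apply: eq_big_seq => F /ht->; ring.
Qed.

End Family.

(** Any [u] is a nonnegative combination of the normals active at a vertex minimizing it, and these
    all lie in the normal cone of that vertex, where [f] is linear. *)
Lemma PL_eq0 (s : seq (set V)) (U : set V -> V) (c : set V -> R) P (f : V -> R) :
  uniq s -> polytope P -> P = [set y | forall i, i \in s -> c i <= dot (U i) y] ->
  PL (normal_fan P) f -> (forall F, F \in s -> f (U F) = 0) -> forall u, f u = 0.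
Proof.
move=> us pP eP fPL fU u; have [v vP vu] := supp_vertex u pP.
have [|a fa] := fPL (normal_cone P [set v]); first by exists [set v] => //; split=> //; exists v.
have [l l0 eu] := farkas_active us pP eP vu.
rewrite fa; last by move=> _ ->; case: vu.
rewrite eu dot_sumr big_seq_cond big1 // => F /andP[Fs /eqP Fv].
rewrite dotZr -fa ?fU ?mulr0 // => _ ->.
by rewrite (suppE vu.1) // => y; rewrite {1}eP Fv; apply.
Qed.

(** The values of the support functions at the [U G] form a square matrix, so the last hypothesis,
    its injectivity, gives spanning as well as independence: values can be matched at all [U G], and
    [PL_eq0] extends the equality to all directions. *)
Lemma polytopal_basis_criterion (s : seq (set V)) (U : set V -> V) (c : set V -> R) P
    (Q : set V -> set V) :
  uniq s -> polytope P -> P = [set y | forall i, i \in s -> c i <= dot (U i) y] ->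
  (forall F, F \in s -> polytope (Q F)) ->
  (forall F, F \in s -> forall x, P x ->
     exists2 y, Q F y & forall u, face_in P u x -> face_in (Q F) u y) ->
  (forall l : set V -> R,
     (forall G, G \in s -> \sum_(F <- s) l F * supp (Q F) (U G) = 0) ->
     forall F, F \in s -> l F = 0) ->
  polytopal_basis (normal_fan P) [set` s] Q /\
  normally_equivalent (minkowski_sum [set` s] Q) P.
Proof.
move=> us pP eP pQ cov inj.
have QPL F : F \in s -> PL (normal_fan P) (supp (Q F)).
  by move=> Fs; apply: PL_cover => //; [exact: pQ | exact: cov].
have span (g : V -> R) : PL (normal_fan P) g ->
    exists l : set V -> R, forall u, g u = \sum_(F <- s) l F * supp (Q F) u.
  move=> gPL; pose N := size s; pose X (i : 'I_N) := nth set0 s i.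
  have Xs i : X i \in s by exact: mem_nth.
  pose A : 'M[R]_N := \matrix_(i, j) supp (Q (X i)) (U (X j)).
  (* Row vectors as coefficient functions, with value 0 outside [s]. *)
  have lam (w : 'rV[R]_N) : exists l : set V -> R, forall i, l (X i) = w 0 i.
    exists (fun F => if insub (index F s) is Some i then w 0 i else 0) => i.
    by rewrite index_uniq // insubT //= => ?; congr (w 0 _); apply: val_inj.
  have sumX (f : set V -> R) : \sum_(F <- s) f F = \sum_i f (X i).
    by rewrite (big_nth set0) big_mkord.
  have freeA : row_free A.
    apply/row_freeP; exists (invmx A); apply: mulmxV.
    rewrite -row_free_unit; apply/inj_row_free => w wA.
    have [l hl] := lam w; apply/rowP => i; rewrite mxE -hl; apply: inj => // G.
    move=> /(nthP set0)[j jN <-]; rewrite sumX.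
    have := congr1 (fun B : 'rV_N => B 0 (Ordinal jN)) wA; rewrite !mxE => e.
    by rewrite -[RHS]e; apply: eq_bigr => k _; rewrite hl !mxE.
  have uA : A \in unitmx by rewrite -row_free_unit.
  have [l hl] := lam ((\row_j g (U (X j))) *m invmx A).
  exists l => u; apply/eqP; rewrite -subr_eq0; apply/eqP.
  pose f (v : V) := g v - \sum_(F <- s) l F * supp (Q F) v.
  apply: (PL_eq0 (f := f) us pP eP) => [C PC|F].
    have [a ga] := gPL C PC.
    have /choice[b hb] (F : set V) : exists b, F \in s -> forall u, C u -> supp (Q F) u = dot b u.
      by have [/QPL/(_ C PC)[b hb]|] := boolP (F \in s); [exists b | exists 0].
    exists (a - \sum_(F <- s) l F *: b F) => v Cv; rewrite /f ga // dotBl dot_suml.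
    by congr (_ - _); apply: eq_big_seq => F Fs; rewrite dotZl hb.
  move=> /(nthP set0)[j jN <-]; rewrite /f sumX.
  have : ((\row_j g (U (X j))) *m invmx A *m A) 0 (Ordinal jN) = g (U (nth set0 s j)).
    by rewrite (mulmxKV uA) mxE.
  rewrite mxE => <-; apply/eqP; rewrite subr_eq0; apply/eqP.
  by apply: eq_bigr => k _; rewrite hl; congr (_ * _); rewrite mxE.
have basis : basis_of_PL (normal_fan P) [set` s] (fun F => supp (Q F)).
  split=> //.
  - move=> l l0 F Fs; apply: inj Fs => G Gs.
    by rewrite -[RHS](l0 (U G)) fsbig_seq.
  - move=> g /span[l gl]; exists l => u.
    by rewrite gl fsbig_seq.
split; first split=> // F Fs.
  by split; [exact: pQ | apply: coarsens_PL => //; [exact: pQ | exact: QPL]].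
have [l hl] := span (supp P) (PL_cover pP pP (fun x Px => ex_intro2 _ _ x Px (fun u => id))).
exact: (normal_fan_minkowski us pQ pP QPL hl).
Qed.

End Fans.

(** * Dimension counts for facets *)

Section FacetRanks.
Context {R : realType}.

(** Subtracting the first row of [Y] from the others gives [k] independent vectors orthogonal to
    [u], which fill the [k]-dimensional kernel of [u]. *)
Let span_has_dimS k (u : 'rV[R]_k.+1) (c : R) (F : set 'rV[R]_k.+1) (Y : 'M[R]_k.+1) :
  row_free Y -> (forall i, F (row i Y)) -> u != 0 -> (forall x, F x -> dot u x = c) ->
  has_dim F k.
Proof.
move=> freeY FY u0 Fu; exists (row ord0 Y), (\matrix_(i < k) (row (lift ord0 i) Y - row ord0 Y)).
set M := \matrix_i _.
have freeM : row_free M.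
  apply: inj_row_free => w wM.
  have /(congr1 (fun B => B *m invmx Y)) : row_mx (- \sum_i w 0 i)%:M w *m (Y : 'M_(1 + k, _)) = 0.
    rewrite -[RHS]wM -[in LHS](vsubmxK (Y : 'M_(1 + k, _))) mul_row_col mul_scalar_mx.
    rewrite !mulmx_sum_row; have -> : usubmx (Y : 'M_(1 + k, _)) = row ord0 Y.
      by apply/rowP => j; rewrite !mxE; congr (Y _ _); apply: val_inj.
    rewrite scaleNr scaler_suml addrC -sumrB; apply: eq_bigr => i _.
    rewrite rowK scalerBr; congr (_ *: _ - _); apply/rowP => j; rewrite !mxE.
    by congr (Y _ _); apply: val_inj.
  rewrite mulmxK ?mul0mx -?row_free_unit // => /(congr1 (@rsubmx _ 1 1 k)).
  by rewrite row_mxKr linear0.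
split=> //.
  by move=> i; rewrite rowK addrC subrK.
have MK : (M <= kermx u^T)%MS.
  apply/sub_kermxP/row_matrixP => i; rewrite row_mul rowK row0.
  by rewrite -[LHS]trmxK trmx_mul trmxK dot_mulmx dotBr !Fu // subrr raddf0 trmx0.
have rk : \rank M = \rank (kermx u^T).
  by rewrite (eqP freeM) mxrank_ker mxrank_tr rank_rV u0 subn1.
have /eqmxP eMK : (M == kermx u^T)%MS by rewrite -(mxrank_leqif_eq MK) rk.
move=> x Fx; rewrite eMK; apply/sub_kermxP.
by rewrite -[LHS]trmxK trmx_mul trmxK dot_mulmx dotBr !Fu // subrr raddf0 trmx0.
Qed.

(** Both forms are constant on [F], so both belong to the line orthogonal to its directions; [d] is
    then a multiple of [u] that vanishes where [u] is the nonzero [c]. *)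
Let has_dim_spanS k (u d : 'rV[R]_k.+1) (c : R) (F : set 'rV[R]_k.+1) :
  has_dim F k -> c != 0 -> (forall x, F x -> dot u x = c) ->
  (forall x, F x -> dot d x = 0) -> d = 0.
Proof.
move=> [x0 [M [Fx0 freeM FM _]]] c0 Fu Fd.
have inK w e : (forall x, F x -> dot w x = e) -> (w <= kermx M^T)%MS.
  move=> Fw; apply/sub_kermxP/trmx_inj; rewrite trmx_mul trmxK trmx0.
  apply/row_matrixP => i; rewrite row_mul row0 -[LHS]trmxK trmx_mul trmxK dot_mulmx.
  rewrite [dot w _](_ : _ = 0) ?raddf0 ?trmx0 //.
  by have := Fw _ (FM i); rewrite dotDr (Fw _ Fx0) => /(canRL (addKr _)); rewrite addNr.
have uK := inK u c Fu.
have u0 : u != 0 by apply: contra c0 => /eqP u0; rewrite -(Fu _ Fx0) u0 dot0l.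
have rk : \rank u = \rank (kermx M^T).
  by rewrite mxrank_ker mxrank_tr (eqP freeM) rank_rV u0 subSnn.
have /eqmxP eu : (u == kermx M^T)%MS by rewrite -(mxrank_leqif_eq uK) rk.
have := inK d 0 Fd; rewrite -eu => /sub_rVP[a da].
have := Fd _ Fx0; rewrite da dotZl (Fu _ Fx0) => /eqP.
by rewrite mulf_eq0 (negPf c0) orbF => /eqP->; rewrite scale0r.
Qed.

Lemma span_has_dim n (u : 'rV[R]_n) (c : R) (F : set 'rV[R]_n) (Y : 'M[R]_n) :
  (0 < n)%N -> row_free Y -> (forall i, F (row i Y)) -> u != 0 ->
  (forall x, F x -> dot u x = c) -> has_dim F n.-1.
Proof. by case: n u F Y => // k u F Y _; exact: span_has_dimS. Qed.

Lemma has_dim_span n k (u d : 'rV[R]_n) (c : R) (F : set 'rV[R]_n) :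
  k.+1 = n -> has_dim F k -> c != 0 -> (forall x, F x -> dot u x = c) ->
  (forall x, F x -> dot d x = 0) -> d = 0.
Proof. by move=> e; case: n / e u d F => u d F; exact: has_dim_spanS. Qed.

Lemma has_dim_full n (S : set 'rV[R]_n) k : has_dim S n -> has_dim S k -> k = n.
Proof.
move=> [x0 [M [Sx0 freeM SM _]]] [y0 [N [_ freeN _ SN]]].
apply/eqP; rewrite eqn_leq -{1}(eqP freeN) rank_leq_col -{1}(eqP freeM) -(eqP freeN) /=.
apply: mxrankS; apply/row_subP => i.
have -> : row i M = (x0 + row i M - y0) - (x0 - y0) by apply/rowP => j; rewrite !mxE; ring.
by apply: addmx_sub; rewrite ?eqmx_opp SN.
Qed.

End FacetRanks.

(** * Separating a point from a polytope by a facet *)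

Section FacetSeparation.
Context {R : realType} {n : nat}.
Local Notation V := 'rV[R]_n.
Implicit Types (u v x y z g d : V) (S : set V).

Lemma interior_supp_lt0 S d : polytope S -> interior S 0 -> d != 0 -> supp S d < 0.
Proof.
move=> pS /nbhs_ballP[e /= e0 eS] d0.
(* [m] strictly exceeds every coordinate of [d] in absolute value, so that [(e / m) *: d] stays in
   the ball of radius [e]. *)
pose m : R := 1 + \sum_i `|d 0 i|.
have m0 : 0 < m by rewrite ltr_wpDr // sumr_ge0.
have Sx : S (- (e / m) *: d).
  apply: eS; split=> // i j; rewrite /ball /= !mxE sub0r normrN mulNr normrN normrM.
  rewrite (gtr0_norm (divr_gt0 e0 m0)) mulrAC ltr_pdivrMr // ltr_pM2l // ord1.
  rewrite /m (bigD1 j) //= addrCA ltrDl ltr_wpDr // sumr_ge0 //.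
apply: le_lt_trans (supp_le pS d Sx) _; rewrite dotZr mulNr oppr_lt0.
by rewrite mulr_gt0 ?divr_gt0 ?dot_gt0.
Qed.

(** Inactive generators become zero rows: the size stays fixed while the rank counts the independent
    active generators. *)
Let active (xs : seq V) u : 'M[R]_(size xs, n) :=
  \matrix_(i < size xs) (if dot u xs`_i == -1 then xs`_i else 0).

(* A valid inequality violated by [z] is rotated, keeping [z] violated, until it
   is tight on [n] linearly independent generators of [S]. *)
Lemma facet_separation S z : polytope S -> has_dim S n -> interior S 0 -> ~ S z ->
  exists u, [/\ facet S (face_in S u), supp S u = -1 & dot u z < -1].
Proof.
move=> pS dS S0 Sz; have [xs xs0 eS] := polytopeP pS.
have S_0 : S 0 := nbhs_singleton S0.
have xsS p : p \in xs -> S p by rewrite eS; exact: sub_conv.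
have [u0 [u0xs u0z]] : exists u, (forall p, p \in xs -> -1 <= dot u p) /\ dot u z < -1.
  apply: contrapT => h; apply: Sz; rewrite eS; apply/convP => g c hc.
  have [g0|g0] := eqVneq g 0.
    by have [p pxs _] := supp_conv 0 xs0; move: (hc p pxs); rewrite g0 !dot0l.
  have c0 : c < 0.
    apply: le_lt_trans (interior_supp_lt0 pS S0 g0).
    by have [p pxs e] := supp_conv g xs0; rewrite eS e; exact: hc.
  rewrite leNgt; apply/negP => zc; apply: h; exists ((- c)^-1 *: g).
  have nc0 : 0 < - c by rewrite oppr_gt0.
  split=> [p /hc pc|]; rewrite dotZl mulrC.
    by rewrite ler_pdivlMr // mulN1r opprK.
  by rewrite ltr_pdivrMr // mulN1r opprK.
have : exists k, (n - \rank (active xs u0) <= k)%N by exists n; exact: leq_subr.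
case=> k; elim: k u0 u0xs u0z => [|k IH] u uxs uz rk; last first.
  have [full|nfull] := boolP (row_full (active xs u)).
    by apply: (IH u) => //; rewrite (eqP full) subnn.
  have [g gA g0] : exists2 g, (forall p, p \in xs -> dot u p = -1 -> dot g p = 0) & g != 0.
    have /rowV0Pn[g /sub_kermxP gK g0] : kermx (active xs u)^T != 0.
      rewrite -mxrank_eq0 mxrank_ker mxrank_tr subn_eq0 -ltnNge ltn_neqAle rank_leq_col andbT.
      exact: nfull.
    exists g => // p pxs /eqP up; have ip : (index p xs < size xs)%N by rewrite index_mem.
    have := congr1 (fun B : 'rV[R]_(size xs) => B 0 (Ordinal ip)) gK; rewrite !mxE => <-.
    by apply: eq_bigr => j _; rewrite !mxE /= nth_index // up.
  wlog gz : g gA g0 / dot g z <= 0.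
    move=> wl; have [gz|gz] := leP (dot g z) 0; first exact: (wl g).
    apply: (wl (- g)); rewrite ?oppr_eq0 //; last by rewrite dotNl oppr_le0 ltW.
    by move=> p pxs /gA; rewrite dotNl => -> //; rewrite oppr0.
  pose ys := [seq p <- xs | dot g p < 0].
  have ys0 : ys != [::].
    have [p pxs e] := supp_conv g xs0; rewrite -eS in e.
    have : p \in ys by rewrite mem_filter -e pxs interior_supp_lt0.
    by apply: contraTneq => ->.
  (* The first generator to become tight as [u] moves along [g]; moving exactly that far keeps all
     inequalities valid. *)
  have [p0 p0ys p0m] := seq_argmin (fun p => (dot u p + 1) / - dot g p) ys0.
  move: p0ys; rewrite mem_filter => /andP[gp0 p0xs].
  set t := (dot u p0 + 1) / _ in p0m.
  have t0 : 0 <= t.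
    apply: divr_ge0; last by rewrite oppr_ge0 ltW.
    by have := uxs _ p0xs; lra.
  have ep0 : dot (u + t *: g) p0 = -1.
    have : t * - dot g p0 = dot u p0 + 1 by rewrite divfK // oppr_eq0 lt_eqF.
    by rewrite mulrN dotDl dotZl; lra.
  have vxs p : p \in xs -> -1 <= dot (u + t *: g) p.
    move=> pxs; rewrite dotDl dotZl; have [gp|gp] := ltP (dot g p) 0.
      have := p0m p; rewrite mem_filter gp pxs => /(_ isT).
      by rewrite ler_pdivlMr ?oppr_gt0 //; lra.
    have := uxs p pxs; have := mulr_ge0 t0 gp; lra.
  apply: (IH (u + t *: g)) => //.
    by rewrite dotDl dotZl; have := mulr_ge0_le0 t0 gz; lra.
  have sub : (active xs u <= active xs (u + t *: g))%MS.
    apply/row_subP => i; rewrite rowK; case: ifP => [/eqP ui|_]; last exact: sub0mx.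
    have ixs : xs`_i \in xs by exact: mem_nth.
    have := row_sub i (active xs (u + t *: g)); rewrite rowK.
    by rewrite dotDl dotZl ui gA // mulr0 addr0 eqxx.
  suff : (\rank (active xs u) < \rank (active xs (u + t *: g)))%N.
    move=> lt; apply: leq_trans (leq_sub2l n lt) _.
    by rewrite subnS -subn1 leq_subLR add1n.
  rewrite (ltn_leqif (mxrank_leqif_sup sub)).
  (* The rank grows, since [g] vanishes on the previously active generators but not on [p0]. *)
  apply/negP => sup; move: gp0; rewrite ltNge => /negP[].
  have ip : (index p0 xs < size xs)%N by rewrite index_mem.
  have := submx_trans (row_sub (Ordinal ip) _) sup.
  rewrite rowK /= nth_index // ep0 eqxx => /submxP[w ->].
  rewrite mulmx_sum_row dot_sumr big1 // => i _; rewrite dotZr rowK.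
  case: ifP => [/eqP ui|_]; last by rewrite dot0r mulr0.
  by rewrite gA ?mulr0 //; exact: mem_nth.
have full : row_full (active xs u).
  by rewrite /row_full eqn_leq rank_leq_col /=; move: rk; rewrite leqn0 subn_eq0.
have Y_free := fullrowsub_free full; set f := fullrankfun full in Y_free.
set Y := rowsub f _ in Y_free.
have n0 : (0 < n)%N.
  rewrite lt0n; apply/eqP => n0; apply: Sz; suff -> : z = 0 by [].
  by apply/rowP => i; have := ltn_ord i; rewrite {2}n0.
have uY : Y \in unitmx := fullrowsub_unit full.
have Yact i : S (row i Y) /\ dot u (row i Y) = -1.
  rewrite row_rowsub rowK; case: eqP => [ui|ui]; first by split=> //; exact/xsS/mem_nth.
  have : row i Y = 0 by rewrite row_rowsub rowK; case: eqP.
  move=> /(congr1 (fun B => (B *m invmx Y) 0 i)); rewrite -row_mul mulmxV // mul0mx !mxE eqxx.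
  by move/eqP; rewrite oner_eq0.
have i0 : 'I_n by exact: Ordinal n0.
have uS : supp S u = -1.
  have [Si ui] := Yact i0; rewrite -ui; apply: suppE => // x.
  by rewrite ui {1}eS => /convP; apply.
have u_n0 : u != 0.
  apply/eqP => u0; have [_ /eqP] := Yact i0.
  by rewrite u0 dot0l eq_sym oppr_eq0 oner_eq0.
exists u; split=> //; split; first by exists u.
exists n.-1; rewrite prednK //; split=> //.
apply: (span_has_dim (u := u) (c := -1) n0 Y_free) => // [i|x [_ ->]//].
by have [Si ui] := Yact i; split; rewrite ?uS.
Qed.

End FacetSeparation.

(** * Primitive lattice vectors *)

Section Lattice.
Context {R : realType} {n : nat}.
Local Notation V := 'rV[R]_n.
Implicit Types (u v w : V).

(** Take the largest [k] by which [u] is divisible; a nonzero integer coordinate of [u] bounds it,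
    and a further divisor of the quotient would contradict maximality. *)
Lemma primitive_multiple u : lattice u -> u != 0 ->
  exists (k : nat) w, [/\ (0 < k)%N, primitive w & u = k%:R *: w].
Proof.
move=> uL u0; have [j uj] : exists j, u 0 j != 0.
  apply: contrapT => h; move/eqP: u0; apply; apply/rowP => j; rewrite mxE.
  by apply: contrapT => /eqP uj; apply: h; exists j.
pose D k := `[< exists2 w, lattice w & u = k%:R *: w >].
have D1 : D 1%N by apply/asboolP; exists u; rewrite // scale1r.
pose K := Num.bound `|u 0 j|.
have Dle k : D k -> (k <= K)%N.
  move=> /asboolP[w wL e]; have wj : w 0 j != 0.
    by apply: contra uj => /eqP wj; rewrite e mxE wj mulr0.
  rewrite -(ler_nat R); apply: le_trans (ltW (archi_boundP (normr_ge0 _))).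
  by rewrite e mxE normrM normr_nat ler_peMr // norm_intr_ge1.
case: (ex_maxnP (ex_intro (fun k => is_true (D k)) 1%N D1) Dle) => k /asboolP[w wL e] kmax.
have w0 : w != 0 by apply: contra u0 => /eqP w0; rewrite e w0 scaler0.
have k0 : (0 < k)%N := kmax _ D1.
exists k, w; split=> //; split=> // l w' w'L e'.
have l0 : (0 < l)%N.
  by rewrite lt0n; apply: contra w0 => /eqP l0; rewrite e' l0 scale0r.
apply/eqP; rewrite eqn_leq l0 andbT -(leq_pmul2l k0) muln1; apply: kmax.
by apply/asboolP; exists w' => //; rewrite e e' scalerA natrM.
Qed.

Lemma dot_int u v : lattice u -> lattice v -> dot u v \is a Num.int.
Proof. by move=> uL vL; apply: rpred_sum => i _; apply: rpredM. Qed.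

Lemma lattice_sub u v : lattice u -> lattice v -> lattice (u - v).
Proof. by move=> uL vL i; rewrite !mxE rpredB. Qed.

End Lattice.

(** * Facets and their primitive normals *)

Section FacetNormals.
Context {R : realType} {n : nat}.
Local Notation V := 'rV[R]_n.
Implicit Types (u v x y z g d w : V) (F G H E : set V).
Context {S : set V} (pS : polytope S) (dS : has_dim S n) (S0 : interior S 0).
Context (rS : rational_facets S).

Local Notation N := (facet_normal S).

(** Each face is the hull of a sublist of the generators, and sublists are indexed by Boolean
    masks. *)
Lemma finite_faces : finite_set (is_face S).
Proof.
have [xs xs0 eS] := polytopeP pS.
pose f (m : (size xs).-tuple bool) : set V := conv [set` mask m xs].
apply: (@sub_finite_set _ _ [set f m | m in [set: (size xs).-tuple bool]]); last first.
  exact/finite_image/finite_finset.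
move=> _ [g ->]; have [_ eF] := face_conv g xs0; rewrite -eS in eF.
rewrite eF filter_mask.
by exists [tuple of map (fun p => dot g p == supp S g) (in_tuple xs)].
Qed.

Lemma facets_seq : exists fs : seq (set V), uniq fs /\ forall G, (G \in fs) = `[< facet S G >].
Proof.
have /finite_seqP[fs e] : finite_set (facet S).
  by apply: sub_finite_set finite_faces => G [].
exists (undup fs); split; first exact: undup_uniq.
move=> G; rewrite mem_undup; apply/idP/asboolP => [Gfs|].
  by rewrite e.
by rewrite {1}e.
Qed.

Lemma facet_dim G : facet S G -> exists2 k, k.+1 = n & has_dim G k.
Proof. by case=> _ [k [dSk dG]]; exists k => //; exact: (has_dim_full dS dSk). Qed.

Lemma facet_neq0 G : facet S G -> G !=set0.
Proof. by move=> /facet_dim[k _ [x [_ [Gx _ _ _]]]]; exists x. Qed.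

Lemma facet_neq G : facet S G -> G <> S.
Proof.
move=> /facet_dim[k kn dG] e; move: dG; rewrite e => dG.
by have := has_dim_full dS dG => kn'; move: kn; rewrite -{1}kn' => /eqP; rewrite eqn_leq ltnn.
Qed.

Lemma facet_proper G : facet S G -> proper_face S G.
Proof. by move=> fG; split; [case: fG | exact: facet_neq0 | exact: facet_neq]. Qed.

(** The choice made by [facet_normal] is not the default: dividing a lattice normal of [G] by a
    positive integer makes it primitive and leaves its face unchanged. *)
Lemma facet_normalP G : facet S G -> primitive (N G) /\ G = face_in S (N G).
Proof.
move=> fG; have [u [uL eG]] := rS fG.
have u0 : u != 0.
  by apply/eqP => u0; apply: (facet_neq fG); rewrite eG u0 face_in0.
have [k [w [k0 wP e]]] := primitive_multiple uL u0.
suff h : primitive w /\ G = face_in S w.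
  by have := @xgetPex _ 0 [set u | primitive u /\ G = face_in S u]; apply; exists w.
split=> //; rewrite eG e; have k0R : 0 < k%:R :> R by rewrite ltr0n.
have [x [Sx wx]] := face_in_neq0 pS w.
have ekw : supp S (k%:R *: w) = k%:R * supp S w.
  rewrite (suppE Sx) ?dotZl ?wx // => y Sy; rewrite !dotZl ler_pM2l //.
  exact: supp_le.
apply/seteqP; split=> y [Sy]; rewrite /face_in /= ekw dotZl; split=> //.
  by apply: (mulfI (lt0r_neq0 k0R)).
by congr (_ * _).
Qed.

Lemma facetE G : facet S G -> face_in S (N G) = G.
Proof. by move=> /facet_normalP[_ {2}->]. Qed.

Lemma facet_normal_neq0 G : facet S G -> N G != 0.
Proof.
by move=> fG; apply/eqP => u0; apply: (facet_neq fG); rewrite -(facetE fG) u0 face_in0.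
Qed.

Lemma facet_supp_lt0 G : facet S G -> supp S (N G) < 0.
Proof. by move=> fG; apply: interior_supp_lt0 => //; exact: facet_normal_neq0. Qed.

(** As the origin is interior, the hyperplane of [G] misses it, so [G] spans the whole space
    linearly. *)
Lemma facet_span G d : facet S G -> (forall x, G x -> dot d x = 0) -> d = 0.
Proof.
move=> fG Gd; have [k kn dG] := facet_dim fG.
apply: (has_dim_span kn dG (lt0r_neq0 (x := - supp S (N G)) _) _ Gd (u := - N G)).
  by rewrite oppr_gt0 facet_supp_lt0.
by move=> x; rewrite -{1}(facetE fG) dotNl => -[_ ->].
Qed.

Lemma facet_normal_unique G u c : facet S G -> (forall x, G x -> dot u x = c) ->
  supp S (N G) *: u = c *: N G.
Proof.
move=> fG Gu; apply/eqP; rewrite -subr_eq0; apply/eqP; apply: (facet_span fG) => x Gx.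
rewrite dotBl !dotZl Gu //; move: Gx; rewrite -{1}(facetE fG) => -[_ ->].
by rewrite mulrC subrr.
Qed.

(** The normal of [H] is constant on [G], so the two normals are proportional, with ratio that of
    their negative minima. *)
Lemma facet_sub_eq G H : facet S G -> facet S H -> G `<=` H -> G = H.
Proof.
move=> fG fH GH; have h : forall x, G x -> dot (N H) x = supp S (N H).
  by move=> x /GH; rewrite -{1}(facetE fH) => -[].
have e := facet_normal_unique fG h.
have a0 := facet_supp_lt0 fG; have b0 := facet_supp_lt0 fH.
apply/seteqP; split=> // x; rewrite -(facetE fH) -[X in _ -> X x](facetE fG) => -[Sx Hx].
split=> //; apply: (mulfI (ltr0_neq0 b0)).
by rewrite -dotZl -e dotZl Hx mulrC.
Qed.

Lemma facets_separate z : ~ S z -> exists2 G, facet S G & dot (N G) z < supp S (N G).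
Proof.
move=> Sz; have [u [fG us uz]] := facet_separation pS dS S0 Sz.
exists (face_in S u) => //; set G := face_in S u in fG *.
have h : forall x, G x -> dot u x = -1 by move=> x [_ ->].
have e := facet_normal_unique fG h; have a0 := facet_supp_lt0 fG.
have -> : N G = (- supp S (N G)) *: u by rewrite scaleNr e scaleN1r opprK.
move: a0; set a := supp S (N G) => a0.
have -> : supp S (- a *: u) = a.
  by rewrite /a scaleNr e scaleN1r opprK.
by rewrite dotZl; have := ltr_nM2l a0 (-1) (dot u z); rewrite uz; lra.
Qed.

(** For a facet [G] this is the lattice distance to its hyperplane. *)
Definition facet_slack G x := dot (N G) x - supp S (N G).

Lemma facet_slack_ge0 G x : S x -> 0 <= facet_slack G x.
Proof. by move=> Sx; rewrite subr_ge0 supp_le. Qed.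

Lemma facet_slack_eq0 G x : facet S G -> S x -> (facet_slack G x = 0) <-> G x.
Proof.
move=> fG Sx; rewrite -[X in _ <-> X x](facetE fG); split.
  by move=> /eqP; rewrite subr_eq0 => /eqP.
by case=> _ e; rewrite /facet_slack e subrr.
Qed.

Lemma facet_slack_gt0 G x : facet S G -> S x -> ~ G x -> 0 < facet_slack G x.
Proof.
move=> fG Sx Gx; rewrite lt0r facet_slack_ge0 // andbT; apply/eqP => e; apply: Gx.
exact/(facet_slack_eq0 fG Sx).
Qed.

(** * The facet inequalities and the slack of a face *)

Context {fs : seq (set V)} (ufs : uniq fs) (fsP : forall G, (G \in fs) = `[< facet S G >]).

Lemma in_facets G : G \in fs -> facet S G.
Proof. by rewrite fsP => /asboolP. Qed.

Lemma facet_ineqs : S = [set x | forall G, G \in fs -> supp S (N G) <= dot (N G) x].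
Proof.
apply/seteqP; split=> x; first by move=> Sx G _; exact: supp_le.
move=> h; apply: contrapT => /facets_separate[G fG]; apply/negP; rewrite -leNgt; apply: h.
by rewrite fsP; exact/asboolP.
Qed.

(* The conic combination of facet normals given by Farkas' lemma at a point of
   [F] only involves facets containing [F]. *)
Lemma face_facets F x : is_face S F -> F !=set0 -> S x ->
  (forall G, facet S G -> F `<=` G -> G x) -> F x.
Proof.
move=> [u ->] [p pF] Sx h.
have [l l0 eu] := farkas_active ufs pS facet_ineqs pF.
split=> //; case: (pF) => Sp <-.
have uE y : dot u y = \sum_(G <- fs | dot (N G) p == supp S (N G)) l G * dot (N G) y.
  by rewrite {1}eu dot_suml; apply: eq_bigr => G _; rewrite dotZl.
rewrite !uE big_seq_cond [RHS]big_seq_cond; apply: eq_bigr => G /andP[Gfs /eqP Gp].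
have fG := in_facets Gfs.
have [->|lG] := eqVneq (l G) 0; first by rewrite !mul0r.
congr (_ * _); rewrite Gp; suff : G x by rewrite -{1}(facetE fG) => -[].
apply: h => // y yF; have Sy := yF.1; apply/(facet_slack_eq0 fG) => //.
have : \sum_(G <- fs | dot (N G) p == supp S (N G)) l G * facet_slack G y = 0.
  have -> : \sum_(G <- fs | dot (N G) p == supp S (N G)) l G * facet_slack G y = dot u y - dot u p.
    by rewrite !uE -sumrB; apply: eq_bigr => K /eqP e; rewrite /facet_slack -e mulrBr.
  by rewrite yF.2 pF.2 subrr.
move/eqP; rewrite psumr_eq0 => [/allP/(_ G Gfs)|K _]; last by rewrite mulr_ge0 ?facet_slack_ge0.
by rewrite Gp eqxx /= mulf_eq0 (negPf lG) => /eqP.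
Qed.

Lemma face_normalE F : face_normal S F = \sum_(G <- fs | `[< F `<=` G >]) N G.
Proof.
rewrite /face_normal (_ : [set G | _] = [set` [seq G <- fs | `[< F `<=` G >]]]).
  by rewrite -fsbig_seq ?filter_uniq // big_filter.
apply/seteqP; split=> G /=.
  by move=> [fG FG]; rewrite mem_filter fsP; apply/andP; split; exact/asboolP.
by rewrite mem_filter fsP => /andP[/asboolP FG /asboolP fG].
Qed.

(** Equal by [slackE] to the form of [F] minus its minimum on [S]; written as a sum, it can be
    compared facet by facet. *)
Definition slack F x := \sum_(G <- fs | `[< F `<=` G >]) facet_slack G x.

Lemma slack_ge0 F x : S x -> 0 <= slack F x.
Proof. by move=> Sx; apply: sumr_ge0 => G _; exact: facet_slack_ge0. Qed.

Lemma slack_in F x : F `<=` S -> F x -> slack F x = 0.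
Proof.
move=> FS Fx; rewrite /slack big_seq_cond big1 // => G /andP[/in_facets fG /asboolP FG].
by apply/(facet_slack_eq0 fG); [exact: FS | exact: FG].
Qed.

Lemma slack_eq0 F x : is_face S F -> F !=set0 -> S x -> slack F x = 0 <-> F x.
Proof.
move=> fF F0 Sx; split=> [/eqP|]; last by apply: slack_in; exact: is_face_sub.
rewrite psumr_eq0 => [/allP h|G _]; last exact: facet_slack_ge0.
apply: face_facets => // G fG FG; apply/(facet_slack_eq0 fG Sx).
by apply/eqP; have := h G; rewrite fsP asboolT // => /(_ isT); rewrite asboolT.
Qed.

Lemma slackE F x : F `<=` S -> F !=set0 ->
  dot (face_normal S F) x - supp S (face_normal S F) = slack F x.
Proof.
move=> FS [p Fp].
have e y : dot (face_normal S F) y = slack F y + \sum_(G <- fs | `[< F `<=` G >]) supp S (N G).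
  by rewrite face_normalE dot_suml -big_split; apply: eq_bigr => G _; rewrite /= subrK.
have -> : supp S (face_normal S F) = dot (face_normal S F) p.
  apply: suppE => [|y Sy]; first exact: FS.
  by rewrite !e (slack_in FS Fp) add0r lerDr slack_ge0.
by rewrite !e (slack_in FS Fp) add0r addrK.
Qed.

Lemma face_in_normal F : is_face S F -> F !=set0 -> face_in S (face_normal S F) = F.
Proof.
move=> fF F0; have FS := is_face_sub fF; apply/seteqP; split=> x.
  move=> [Sx e]; apply/(slack_eq0 fF F0 Sx).
  by rewrite -slackE // e subrr.
move=> Fx; split; first exact: FS.
by apply/eqP; rewrite -subr_eq0 slackE // slack_in.
Qed.

Lemma proper_face_facet F : proper_face S F -> exists2 G, facet S G & F `<=` G.
Proof.
move=> [fF F0 FS]; apply: contrapT => h; apply: FS; apply/seteqP; split.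
  exact: is_face_sub.
move=> x Sx; apply: face_facets => // G fG FG; case: h; exists G => //.
Qed.

Lemma slack_antitone F K x : S x -> F `<=` K -> slack K x <= slack F x.
Proof.
move=> Sx FK; rewrite /slack big_mkcond [leRHS]big_mkcond; apply: ler_sum => G _.
case: asboolP => [KG|_]; last by case: ifP => // _; exact: facet_slack_ge0.
by rewrite asboolT //; exact: subset_trans KG.
Qed.

Lemma facet_slack_le F G x : S x -> facet S G -> F `<=` G -> facet_slack G x <= slack F x.
Proof.
move=> Sx fG FG; rewrite /slack -big_filter (big_rem G) /=; last first.
  by rewrite mem_filter fsP !asboolT.
by rewrite lerDl; apply: sumr_ge0 => K _; exact: facet_slack_ge0.
Qed.

Lemma slack_facet G x : facet S G -> slack G x = facet_slack G x.
Proof.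
move=> fG; rewrite /slack -big_filter (_ : [seq _ <- _ | _] = [:: G]) ?big_seq1 //.
rewrite -(filter_pred1_uniq ufs (_ : G \in fs)); last by rewrite fsP asboolT.
apply: eq_in_filter => H /in_facets fH; apply/asboolP/eqP => [|->//].
by move=> /(facet_sub_eq fG fH).
Qed.

(** * Vertices and edges of a simple polytope *)

Context (simpS : forall v, vertex S v -> ([set G | facet S G /\ G v] #= `I_n)%card).

(** Otherwise small steps from [v] along both [d] and [- d] stay in [S], which is impossible at a
    vertex. *)
Lemma vertex_normals_span v d : vertex S v ->
  (forall G, facet S G -> G v -> dot (N G) d = 0) -> d = 0.
Proof.
move=> vS h; have Sv := vertex_in vS; have [a ea] := vS.
have [G Gfs|G Gfs /(facet_slack_eq0 (in_facets Gfs) Sv) Gv|L L0 hL] :=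
  @big_multiplier _ _ fs (fun G => - `|dot (N G) d|) (fun G => facet_slack G v).
- exact: facet_slack_ge0.
- by rewrite h ?normr0 ?oppr0 //; exact: in_facets.
have inS t : `|t| = L^-1 -> S (v + t *: d).
  move=> tL; rewrite facet_ineqs => G Gfs; rewrite dotDr dotZr.
  have := hL _ (lexx L) G Gfs; rewrite -(pmulr_rge0 _ (_ : 0 < L^-1)) ?invr_gt0 //.
  rewrite mulrDr mulKf ?gt_eqF // -tL mulrN -normrM /facet_slack.
  by have := ler_norm (- (t * dot (N G) d)); rewrite normrN; lra.
have Li : 0 < L^-1 by rewrite invr_gt0.
apply: contrapT => /eqP d0.
have ne t : `|t| = L^-1 -> v + t *: d != v.
  move=> tL; rewrite -subr_eq0 addrAC subrr add0r scaler_eq0 negb_or d0 andbT.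
  by rewrite -normr_gt0 tL.
have := vertex_lt pS ea (inS L^-1 (gtr0_norm Li)) (ne L^-1 (gtr0_norm Li)).
have nL : `|- L^-1| = L^-1 by rewrite normrN gtr0_norm.
have := vertex_lt pS ea (inS _ nL) (ne _ nL).
by rewrite !dotE; lra.
Qed.

(** By simplicity the normals at [v] form a square matrix, invertible by [vertex_normals_span]; [d]
    is a column of its inverse. *)
Lemma dual_direction v H : vertex S v -> facet S H -> H v ->
  exists2 d, dot (N H) d = 1 & forall G, facet S G -> G v -> G <> H -> dot (N G) d = 0.
Proof.
move=> vS fH Hv; pose gs : seq (set V) := [seq G <- fs | `[< G v >]].
have gsP G : G \in gs <-> facet S G /\ G v.
  rewrite mem_filter fsP; split=> [/andP[/asboolP Gv /asboolP fG] //|[fG Gv]].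
  by rewrite !asboolT.
have ugs : uniq gs by exact: filter_uniq.
have sgs : size gs = n.
  have := simpS vS; rewrite (_ : [set G | _] = [set` seq_fset tt gs]).
    by move/card_eq_fsetP; rewrite size_seq_fset undup_id.
  apply/seteqP; split=> G /=; first by move=> /gsP h; rewrite (seq_fsetE tt gs G).
  by rewrite (seq_fsetE tt gs G) => /gsP.
pose U : 'M[R]_n := \matrix_(i < n) N (nth set0 gs i).
have ith (i : 'I_n) : nth set0 gs i \in gs by rewrite mem_nth // sgs.
have freeU : row_free U^T.
  apply: inj_row_free => w wU; apply: (vertex_normals_span vS) => G fG Gv.
  have /(nthP set0)[j jn <-] : G \in gs by apply/gsP.
  rewrite sgs in jn; have := congr1 (fun B : 'rV[R]_n => B 0 (Ordinal jn)) wU.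
  by rewrite !mxE dotC => <-; apply: eq_bigr => k _; rewrite !mxE.
have uU : U \in unitmx by rewrite -unitmx_tr -row_free_unit.
have /(nthP set0)[j jn ej] : H \in gs by apply/gsP.
rewrite sgs in jn; exists (col (Ordinal jn) (invmx U))^T.
  have := congr1 (fun B : 'M[R]_n => B (Ordinal jn) (Ordinal jn)) (mulmxV uU).
  rewrite !mxE eqxx => e; apply: etrans e.
  by apply: eq_bigr => k _; rewrite !mxE /= ej.
move=> G fG Gv GH; have /(nthP set0)[i is_n ei] : G \in gs by apply/gsP.
rewrite sgs in is_n.
have := congr1 (fun B : 'M[R]_n => B (Ordinal is_n) (Ordinal jn)) (mulmxV uU).
rewrite !mxE; case: eqP => [[ij]|_]; first by case: GH; rewrite -ei -ej ij.
move=> e; apply: etrans e.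
by apply: eq_bigr => k _; rewrite !mxE /= ei.
Qed.

Lemma facet_slack_affine G x d (t : R) :
  facet_slack G (x + t *: d) = facet_slack G x + t * dot (N G) d.
Proof. by rewrite /facet_slack dotDr dotZr addrAC. Qed.

Lemma facet_slack_sub G x y : facet_slack G x - facet_slack G y = dot (N G) (x - y).
Proof. by rewrite /facet_slack dotBr; lra. Qed.

(** [E] is cut out by the facets through [v] other than [H]. It lies on the ray from [v] in the dual
    direction of [H], and [y] is its vertex farthest from [H]. *)
Lemma simple_edge v H : vertex S v -> facet S H -> H v ->
  exists y E, [/\ edge S E, E v, E y, vertex S y /\ ~ H y &
    forall G, facet S G -> G v -> G <> H -> G y].
Proof.
move=> vS fH Hv; have Sv := vertex_in vS; have [d Hd Gd] := dual_direction vS fH Hv.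
pose on G := `[< G v /\ G <> H >].
pose E := face_in S (\sum_(G <- fs | on G) N G).
have v0 G : G \in fs -> G v -> facet_slack G v = 0.
  by move=> Gfs Gv; apply/(facet_slack_eq0 (in_facets Gfs) Sv).
have gE z : dot (\sum_(G <- fs | on G) N G) z - dot (\sum_(G <- fs | on G) N G) v =
    \sum_(G <- fs | on G) facet_slack G z.
  rewrite !dot_suml -sumrB big_seq_cond [RHS]big_seq_cond; apply: eq_bigr => G.
  move=> /andP[Gfs /asboolP[Gv _]].
  by rewrite -dotBr -facet_slack_sub v0 // subr0.
have Ev : E v.
  apply: face_in_min => // y Sy; rewrite -subr_ge0 gE.
  by apply: sumr_ge0 => G _; exact: facet_slack_ge0.
have EP z : S z -> E z <-> forall G, facet S G -> G v -> G <> H -> G z.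
  move=> Sz; split=> [[_ ez]|h].
    move: (gE z); rewrite ez -Ev.2 subrr => /esym/eqP.
    rewrite psumr_eq0 => [/allP h G fG Gv GH|G _]; last exact: facet_slack_ge0.
    have Gfs : G \in fs by rewrite fsP asboolT.
    have := h G Gfs; rewrite /on asboolT // => /eqP.
    by move/(facet_slack_eq0 fG Sz).
  split=> //; rewrite -[RHS]Ev.2; apply/eqP; rewrite -subr_eq0 gE.
  rewrite big_seq_cond big1 // => G /andP[/in_facets fG /asboolP[Gv GH]].
  by apply/(facet_slack_eq0 fG Sz); exact: h.
have Ed z : E z -> z - v = facet_slack H z *: d.
  move=> Ez; have Sz := Ez.1; apply/eqP; rewrite -subr_eq0; apply/eqP.
  apply: (vertex_normals_span vS) => G fG Gv; have Gfs : G \in fs by rewrite fsP asboolT.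
  rewrite dotBr dotZr -facet_slack_sub v0 // subr0.
  have [->|/eqP GH] := eqVneq G H; first by rewrite Hd mulr1 subrr.
  rewrite Gd // mulr0 subr0; apply/(facet_slack_eq0 fG Sz).
  exact: ((EP _ Sz).1 Ez).
have [G Gfs|G Gfs /(facet_slack_eq0 (in_facets Gfs) Sv) Gv|L L0 hL] :=
  @big_multiplier _ _ fs (fun G => dot (N G) d) (fun G => facet_slack G v).
- exact: facet_slack_ge0.
- have [->|/eqP GH] := eqVneq G H; first by rewrite Hd ler01.
  by rewrite Gd ?lexx //; exact: in_facets.
have Li : 0 < L^-1 by rewrite invr_gt0.
have Sp : S (v + L^-1 *: d).
  rewrite facet_ineqs => G Gfs; rewrite -subr_ge0 -/(facet_slack G _) facet_slack_affine.
  have := mulr_ge0 (ltW Li) (hL _ (lexx L) G Gfs).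
  by rewrite mulrDr mulKf ?gt_eqF // addrC.
have Ep : E (v + L^-1 *: d).
  apply/(EP _ Sp) => G fG Gv GH; apply/(facet_slack_eq0 fG Sp).
  rewrite facet_slack_affine Gd // mulr0 addr0.
  by apply/(facet_slack_eq0 fG Sv).
have fE : is_face S E by exists (\sum_(G <- fs | on G) N G).
have pE := is_face_polytope pS fE.
have [y yE ym] := supp_vertex (- N H) pE.
have Ey := vertex_in yE; have Sy := Ey.1.
have yH : 0 < facet_slack H y.
  apply: lt_le_trans Li _.
  have := face_inP pE ym Ep; rewrite !dotNl lerN2 -(lerD2r (- supp S (N H))).
  rewrite -/(facet_slack H _) facet_slack_affine Hd mulr1 /= => h.
  by apply: le_trans h; rewrite lerDr facet_slack_ge0.
have nHy : ~ H y by move=> /(facet_slack_eq0 fH Sy) e; move: yH; rewrite e ltxx.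
exists y, E; split=> //.
- split=> //; have yv : y != v by apply/eqP => yv; apply: nHy; rewrite yv.
  apply: (has_dim1 Ev Ey yv) => x Ex.
  exists (facet_slack H x / facet_slack H y); rewrite Ed // (Ed y) //.
  by rewrite scalerA divfK // gt_eqF.
- by split=> //; exact: face_vertex yE.
- exact: ((EP _ Sy).1 Ey).
Qed.

(** Up to scaling, the edge vectors [Y H - v] are dual to the facet normals at [v], so applying
    these normals to both sides verifies the expansion. *)
Lemma vertex_cone v z (Y : set V -> V) : vertex S v ->
  (forall H, facet S H -> H v -> [/\ S (Y H), ~ H (Y H) &
     forall G, facet S G -> G v -> G <> H -> G (Y H)]) ->
  z - v = \sum_(H <- fs | `[< H v >])
    (facet_slack H z / facet_slack H (Y H)) *: (Y H - v).
Proof.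
move=> vS YP; have Sv := vertex_in vS.
apply/eqP; rewrite -subr_eq0; apply/eqP; apply: (vertex_normals_span vS) => G fG Gv.
have Gfs : G \in fs by rewrite fsP asboolT.
have Gv0 : facet_slack G v = 0 by apply/(facet_slack_eq0 fG Sv).
rewrite dotBr dot_sumr -facet_slack_sub Gv0 subr0 -big_filter (bigD1_seq G) /=; last 2 first.
- by rewrite mem_filter asboolT.
- exact: filter_uniq.
have [SY GY _] := YP G fG Gv.
rewrite dotZr -facet_slack_sub Gv0 subr0 divfK; last by rewrite gt_eqF // facet_slack_gt0.
rewrite big_filter_cond big_seq_cond big1 ?addr0 ?subrr //.
move=> H /and3P[/in_facets fH /asboolP Hv /eqP HG]; have [SYH _ YG] := YP H fH Hv.
rewrite dotZr -facet_slack_sub Gv0 subr0 [facet_slack G _](_ : _ = 0) ?mulr0 //.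
by apply/(facet_slack_eq0 fG SYH); apply: YG => // e; apply: HG; rewrite e.
Qed.

Lemma segment_in x y (t : R) : S x -> S y -> 0 <= t <= 1 -> S (x + t *: (y - x)).
Proof.
move=> Sx Sy /andP[t0 t1]; rewrite facet_ineqs => G Gfs.
rewrite -subr_ge0 -/(facet_slack G _) facet_slack_affine -facet_slack_sub.
have -> : facet_slack G x + t * (facet_slack G y - facet_slack G x) =
  (1 - t) * facet_slack G x + t * facet_slack G y by ring.
by rewrite addr_ge0 // mulr_ge0 ?facet_slack_ge0 // subr_ge0.
Qed.

(** * Truncations along a single face *)

Lemma TrE F (e : R) : proper_face S F -> Tr e S F = [set x | S x /\ e <= slack F x].
Proof.
move=> [fF F0 _]; have FS := is_face_sub fF.
apply/seteqP; split=> x [Sx] /=; have := slackE x FS F0 => e' h; split=> //; lra.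
Qed.

Lemma slack_ge_depth F v : proper_face S F -> vertex S v -> ~ F v ->
  depth S F (face_normal S F) <= slack F v.
Proof.
move=> [fF F0 _] vS Fv; have FS := is_face_sub fF.
have := @depth_le_vertex _ _ S (face_normal S F) v pS vS.
by rewrite face_in_normal // slackE //; apply.
Qed.

(** Among the facets through [v] only [H] can miss [y], so only [H] can contribute. *)
Lemma edge_slack v F H y : vertex S v -> F v -> facet S H -> S y ->
  (forall G, facet S G -> G v -> G <> H -> G y) ->
  slack F y = if `[< F `<=` H >] then facet_slack H y else 0.
Proof.
move=> vS Fv fH Sy Hy; rewrite /slack big_seq_cond; case: asboolP => FH.
  rewrite -big_seq_cond -big_filter (bigD1_seq H) /=; last 2 first.
  - by rewrite mem_filter fsP !asboolT.
  - exact: filter_uniq.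
  rewrite big_filter_cond big_seq_cond big1 ?addr0 //.
  move=> K /and3P[/in_facets fK /asboolP FK /eqP KH].
  by apply/(facet_slack_eq0 fK Sy); exact: (Hy _ fK (FK _ Fv)).
rewrite big1 // => K /andP[/in_facets fK /asboolP FK].
by apply/(facet_slack_eq0 fK Sy)/(Hy _ fK (FK _ Fv)) => KH; apply: FH; rewrite -KH.
Qed.

(* If [w] is in [G], the point is taken on the edge leaving [H] at [w]. *)
Lemma truncation_point G w (X : set (set V)) (e : R) :
  proper_face S G -> 0 < e -> e <= depth S G (face_normal S G) -> vertex S w ->
  (forall F, X F -> F `<=` S /\ F w) ->
  (G w -> exists2 H, facet S H /\ G `<=` H &
     forall F, X F -> F `<=` H -> F `<=` G) ->
  exists2 p, Tr e S G p &
    forall F, X F -> slack F p = if `[< F `<=` G >] then e else 0.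
Proof.
move=> pG e0 ed wS XP hG; have Sw := vertex_in wS.
have [Gw|Gw] := pselect (G w); last first.
  exists w; first by rewrite TrE //; split=> //; apply: le_trans ed _; exact: slack_ge_depth.
  move=> F /XP[FS Fw]; rewrite slack_in // asboolF // => FG; exact/Gw/FG.
have [H [fH GH] HX] := hG Gw.
have [y [E [eE Ew Ey [yS Hy] Fy]]] := simple_edge wS fH (GH _ Gw).
have Sy := vertex_in yS.
have sy F (Fw : F w) := edge_slack wS Fw fH Sy Fy.
have Hy0 := facet_slack_gt0 fH Sy Hy.
have eH : e <= facet_slack H y.
  apply: le_trans ed _; have := sy G Gw; rewrite asboolT // => <-.
  by apply: slack_ge_depth => // /GH.
pose t := e / facet_slack H y.
have Sp : S (w + t *: (y - w)).
  apply: segment_in => //; rewrite (divr_ge0 (ltW e0) (ltW Hy0)) /=.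
  by rewrite ler_pdivrMr // mul1r.
have sp F : F w -> slack F (w + t *: (y - w)) = if `[< F `<=` H >] then e else 0.
  move=> Fw; have -> : slack F (w + t *: (y - w)) = t * slack F y.
    rewrite /slack mulr_sumr big_seq_cond [RHS]big_seq_cond; apply: eq_bigr => K.
    move=> /andP[/in_facets fK /asboolP FK].
    have Kw : facet_slack K w = 0 by apply/(facet_slack_eq0 fK Sw)/FK.
    by rewrite facet_slack_affine -facet_slack_sub Kw add0r subr0.
  by rewrite sy //; case: asboolP => _; rewrite ?mulr0 // divfK // gt_eqF.
exists (w + t *: (y - w)); first by rewrite TrE //; split=> //; rewrite sp // asboolT.
move=> F XF; have [FS Fw] := XP F XF; rewrite sp //; congr (if _ then _ else _).
by apply/asboolP/asboolP => [/(HX F XF)|FG] //; exact: subset_trans GH.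
Qed.

Lemma polytope_Tr G (e : R) : proper_face S G -> 0 < e ->
  e <= depth S G (face_normal S G) -> polytope (Tr e S G).
Proof.
move=> pG e0 ed; apply: polytope_truncation => //.
have [fG G0 _] := pG; have [v vS Gv] := face_has_vertex pS fG.
have [H fH GH] := proper_face_facet pG.
have [p pT _] := @truncation_point G v [set F | F = G] e pG e0 ed vS
  (fun F e => eq_ind_r (fun F => F `<=` S /\ F v) (conj (is_face_sub fG) Gv) e)
  (fun _ => ex_intro2 _ _ H (conj fH GH) (fun F e _ => eq_ind_r (fun F => F `<=` G) (fun x h => h) e)).
by exists p.
Qed.

Lemma face_diff_vertex F G : is_face S F -> is_face S G -> G !=set0 ->
  ~ F `<=` G -> exists v, [/\ vertex S v, F v & ~ G v].
Proof.
move=> fF fG G0 FG; apply: contrapT => h; apply: FG => x Fx.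
have pF := is_face_polytope pS fF; have Sx := is_face_sub fF Fx.
have GS := is_face_sub fG.
apply/(slack_eq0 fG G0 Sx)/eqP; rewrite eq_le slack_ge0 // andbT -slackE //.
rewrite subr_le0 -lerN2 -dotNl; apply: (vertex_le pF) => // v vF.
rewrite dotNl lerN2 -subr_le0 slackE // slack_in //.
apply: contrapT => Gv; apply: h; exists v; split=> //; first exact: face_vertex vF.
exact: vertex_in vF.
Qed.

(** The lower bound is [slack_antitone]. It is attained at the point that [truncation_point] builds
    from a vertex of [F], taken outside [G] unless [F] lies in [G]. *)
Lemma supp_Tr F G (e : R) : proper_face S F -> proper_face S G -> 0 < e ->
  e <= depth S G (face_normal S G) ->
  supp (Tr e S G) (face_normal S F) =
    supp S (face_normal S F) + (if `[< F `<=` G >] then e else 0).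
Proof.
move=> [fF F0 _] pG e0 ed; have [fG G0 _] := pG.
have FS := is_face_sub fF.
have [w [wS Fw Gw]] : exists w, [/\ vertex S w, F w & G w -> F `<=` G].
  have [FG|FG] := pselect (F `<=` G).
    by have [w wS Fw] := face_has_vertex pS fF; exists w; split.
  by have [w [wS Fw Gw]] := face_diff_vertex fF fG G0 FG; exists w; split.
have [H fH GH] := proper_face_facet pG.
have [|/Gw FG|p pT /(_ F erefl) Fp] := @truncation_point G w [set K | K = F] e pG e0 ed wS.
- by move=> K ->; split.
- by exists H => // K ->.
have eF x : dot (face_normal S F) x = supp S (face_normal S F) + slack F x.
  by rewrite -slackE // addrC subrK.
rewrite (suppE pT) ?eF ?Fp // => y; rewrite !eF ?Fp lerD2l TrE // => -[Sy ey].
case: asboolP => [FG|_]; last exact: slack_ge0.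
exact: le_trans (slack_antitone Sy FG).
Qed.

(** * Smooth polytopes with edges of lattice length 1 *)

Context (smS : smooth_polytope S) (len1 : forall E, edge S E -> lattice_length1 E).

Let vertex_lattice v : vertex S v -> lattice v. Proof. by case: smS => _ _ h _; exact: h. Qed.

(** If [y - v] were a multiple [k] of a primitive [w] with [1 < k], the lattice point [v + w] would
    lie strictly inside the edge, yet be one of its vertices by the length condition. *)
Lemma primitive_edge v H : vertex S v -> facet S H -> H v ->
  exists y E, [/\ edge S E, E v, E y, vertex S y /\ ~ H y &
    (forall G, facet S G -> G v -> G <> H -> G y) /\ edge_direction S v (y - v)].
Proof.
move=> vS fH Hv; have [y [E [eE Ev Ey [yS Hy] Gy]]] := simple_edge vS fH Hv.
exists y, E; split=> //; split=> //.
have [fE dE] := eE; have pE := is_face_polytope pS fE.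
have yv : y - v != 0 by rewrite subr_eq0; apply/eqP => yv; apply: Hy; rewrite yv.
have [k [w [k0 wP e]]] := primitive_multiple (lattice_sub (vertex_lattice yS) (vertex_lattice vS)) yv.
have k0R : 0 < k%:R :> R by rewrite ltr0n.
have ew : w = k%:R^-1 *: (y - v) by rewrite e scalerA mulVf ?scale1r // gt_eqF.
have Ew : E (v + w).
  case: fE => g gE; rewrite gE in Ev Ey *; split.
    rewrite ew; apply: segment_in; [exact: Ev.1 | exact: Ey.1|].
    by rewrite invr_ge0 ltW //= invf_le1 // ler1n.
  by rewrite ew dotDr dotZr dotBr Ev.2 Ey.2 subrr mulr0 addr0.
have wL : lattice (v + w).
  by move=> i; rewrite mxE rpredD //; [exact: vertex_lattice | case: wP => wL _; exact: wL].
have [a ea] : vertex E (v + w) by apply/(len1 eE Ew).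
have k1 : k = 1%N.
  have w0 : w != 0 by apply: contra yv => /eqP w0; rewrite e w0 scaler0.
  apply/eqP; rewrite eqn_leq k0 andbT leqNgt; apply/negP => k1.
  have hv := vertex_lt pE ea Ev; have hy := vertex_lt pE ea Ey.
  have wa : dot a w < 0.
    have : 0 < dot a (v - (v + w)).
      by apply: hv; rewrite -subr_eq0 opprD addrA subrr add0r oppr_eq0.
    by rewrite !dotE; lra.
  have ey : y - (v + w) = (k%:R - 1) *: w by rewrite opprD addrA e scalerBl scale1r.
  have k10 : 0 < k%:R - 1 :> R by rewrite subr_gt0 ltr1n.
  have : 0 < dot a (y - (v + w)).
    by apply: hy; rewrite -subr_eq0 ey scaler_eq0 negb_or w0 andbT gt_eqF.
  by rewrite ey dotZr pmulr_rgt0 // ltNge ltW.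
have {}e : y - v = w by rewrite e k1 scale1r.
by rewrite e; split=> //; exists E, 1; split=> //; rewrite scale1r.
Qed.

Lemma dim1_parallel E x y z : has_dim E 1 -> E x -> E y -> E z -> y != x ->
  exists a : R, z - x = a *: (y - x).
Proof.
move=> [x0 [M [_ _ _ EM]]] Ex Ey Ez yx.
have line p : E p -> exists a : R, p - x0 = a *: M by move=> /EM/sub_rVP.
have [ax hx] := line x Ex; have [ay hy] := line y Ey; have [az hz] := line z Ez.
have e p b : p - x0 = b *: M -> p - x = (b - ax) *: M.
  by move=> h; rewrite scalerBl -h -hx opprB addrA subrK.
have yax : ay - ax != 0.
  by apply: contra yx => /eqP a0; rewrite -subr_eq0 (e y ay) // a0 scale0r.
exists ((az - ax) / (ay - ax)).
by rewrite (e z az) // (e y ay) // scalerA divfK.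
Qed.

(** A nonzero coordinate [j] gives the integer relation between [w] and [w'] with coefficients
    [w' 0 j] and [- w 0 j]. *)
Lemma lattice_basis_parallel (X : set V) w w' (a : R) :
  lattice_basis X -> X w -> X w' -> w' != 0 -> w = a *: w' -> w = w'.
Proof.
move=> [finX XL Xfree _] Xw Xw' w'0 e; apply: contrapT => ww'.
have [j wj] : exists j, w' 0 j != 0.
  apply: contrapT => h; move/eqP: w'0; apply; apply/rowP => j; rewrite mxE.
  by apply: contrapT => /eqP wj; apply: h; exists j.
have /intrP[p ep] := XL w' Xw' j; have /intrP[q eq] := XL w Xw j.
pose c (z : V) : int := if z == w then p else if z == w' then - q else 0.
have /finite_seqP[r0 er0] := finX.
pose r := undup r0; have er : X = [set` r].
  by rewrite er0; apply/seteqP; split=> z /=; rewrite mem_undup.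
have wr : w \in r by move: Xw; rewrite er.
have w'r : w' \in r by move: Xw'; rewrite er.
suff c0 : \sum_(z \in X) z *~ c z = 0.
  have := Xfree c c0 w Xw; rewrite /c eqxx => p0.
  by move: wj; rewrite ep p0 eqxx.
rewrite er -fsbig_seq ?undup_uniq // (bigD1_seq w) ?undup_uniq //=.
rewrite -big_filter (bigD1_seq w') ?filter_uniq ?undup_uniq //=; last first.
  by rewrite mem_filter w'r andbT; apply/eqP => h; apply: ww'.
rewrite big1_seq ?addr0 => [|z /andP[zw' ]]; last first.
  by rewrite mem_filter /c (negPf zw') => /andP[/negPf-> _]; rewrite mulr0z.
rewrite /c eqxx eqxx ifN; last by apply/eqP => h; apply: ww'.
rewrite -!scaler_int mulrNz -ep -eq scaleNr {1}e scalerA e mxE mulrC subrr //.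
Qed.

(** The edge directions at [v] form a lattice basis, and the normal of [H] vanishes on all of them
    but [Y H - v]. So its values on the lattice are multiples of the slack of [Y H], and primitivity
    makes this slack 1. *)
Lemma unit_edge_family v : vertex S v -> exists Y : set V -> V,
  forall H, facet S H -> H v ->
    [/\ vertex S (Y H), ~ H (Y H), facet_slack H (Y H) = 1,
      forall G, facet S G -> G v -> G <> H -> G (Y H) &
      exists E, [/\ edge S E, E v & E (Y H)]].
Proof.
move=> vS; have Sv := vertex_in vS.
have /choice[Y hY] (H : set V) : exists y, facet S H -> H v ->
    [/\ vertex S y, ~ H y, edge_direction S v (y - v),
      forall G, facet S G -> G v -> G <> H -> G y & exists E, [/\ edge S E, E v & E y]].
  have [[fH Hv]|h] := pselect (facet S H /\ H v); last first.
    by exists 0 => fH Hv; case: h.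
  have [y [E [eE Ev Ey [yS Hy] [Gy dy]]]] := primitive_edge vS fH Hv.
  by exists y => _ _; split=> //; exists E.
exists Y => H fH Hv; have [YS HY YD GY YE] := hY H fH Hv; split=> //.
have [_ _ _ /(_ v vS) basis] := smS; have [finX XL _ Xspan] := basis.
have Yin K : facet S K -> K v -> [/\ S (Y K), ~ K (Y K) &
    forall G, facet S G -> G v -> G <> K -> G (Y K)].
  by move=> fK Kv; have [YK nK _ GK _] := hY K fK Kv; split=> //; exact: vertex_in.
have sl0 : facet_slack H v = 0 by apply/(facet_slack_eq0 fH Sv).
have slY : 0 < facet_slack H (Y H) by apply: facet_slack_gt0 => //; exact: vertex_in.
have kE : facet_slack H (Y H) = dot (N H) (Y H - v) by rewrite -facet_slack_sub sl0 subr0.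
have dir w : edge_direction S v w -> dot (N H) w = 0 \/ w = Y H - v.
  move=> wD; have [wP [E [t [eE Ev t0 Ew]]]] := wD.
  have [fE dE] := eE; have Sw := is_face_sub fE Ew.
  have [->|Hw] := eqVneq (dot (N H) w) 0; [by left | right].
  have slw K : facet S K -> K v -> facet_slack K (v + t *: w) = t * dot (N K) w.
    by move=> fK Kv; rewrite facet_slack_affine (facet_slack_eq0 fK Sv).2 // add0r.
  have Hw0 : 0 < facet_slack H (v + t *: w).
    by rewrite lt0r facet_slack_ge0 // andbT slw // mulf_neq0 // gt_eqF.
  (* In the [vertex_cone] expansion of a point of [E] off [H], the coefficient of [Y H - v] is
     positive; a form exposing [E] therefore cannot increase towards [Y H]. *)
  have EY : E (Y H).
    case: fE => g gE; rewrite gE in Ev Ew *.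
    have := congr1 (dot g) (vertex_cone (v + t *: w) vS Yin).
    rewrite dot_sumr dotBr Ew.2 Ev.2 subrr => /esym/eqP.
    have gY K : K \in fs -> K v -> 0 <= dot g (Y K - v).
      move=> /in_facets fK Kv; have [SY _ _] := Yin K fK Kv.
      by rewrite dotBr subr_ge0 (face_inP pS Ev).
    rewrite big_seq_cond psumr_eq0 => [/allP/(_ H)|K /andP[Kfs /asboolP Kv]]; last first.
      rewrite dotZr mulr_ge0 ?gY // divr_ge0 ?facet_slack_ge0 //.
      by have [] := Yin K (in_facets Kfs) Kv.
    have Hfs : H \in fs by rewrite fsP asboolT.
    rewrite Hfs asboolT // dotZr mulf_eq0 mulf_eq0 invr_eq0 (gt_eqF Hw0) (gt_eqF slY) /= => /(_ isT).
    rewrite dotBr subr_eq0 => /eqP e; split; first exact: vertex_in.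
    by rewrite e Ev.2.
  have Yv : Y H != v by apply/eqP => e; apply: HY; rewrite e.
  have [a ea] := dim1_parallel dE Ev EY Ew Yv.
  apply: (lattice_basis_parallel basis (a := a / t)) => //.
    by rewrite subr_eq0.
  move: ea; rewrite addrAC subrr add0r => ea.
  by rewrite mulrC -scalerA -ea scalerA mulVf ?scale1r // gt_eqF.
have [[NL Nprim] _] := facet_normalP fH.
have /natrP[k ek] : facet_slack H (Y H) \is a Num.nat.
  rewrite natrEint ltW // andbT kE; apply: dot_int => //.
  by apply: lattice_sub; exact: vertex_lattice.
rewrite ek; suff -> : k = 1%N by [].
have /choice[m hm] (j : 'I_n) : exists m : int, N H 0 j = k%:R * m%:~R.
  have deltaL : lattice (delta_mx 0 j : V).
    by move=> i; rewrite mxE; case: (_ && _); rewrite ?rpred1 ?rpred0.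
  have [c ec] := Xspan _ deltaL.
  have /finite_seqP[r0 er0] := finX.
  pose r := undup r0; have er : edge_direction S v = [set` r].
    by rewrite er0; apply/seteqP; split=> z /=; rewrite mem_undup.
  exists (\sum_(w <- r) (if w == Y H - v then c w else 0)).
  transitivity (dot (N H) (delta_mx 0 j)).
    rewrite /dot (bigD1 j) //= mxE !eqxx mulr1 big1 ?addr0 // => i ij.
    by rewrite mxE (negPf ij) andbF mulr0.
  rewrite ec er -fsbig_seq ?undup_uniq // dot_sumr raddf_sum mulr_sumr.
  apply: eq_big_seq => w wr; have wD : edge_direction S v w by rewrite er.
  rewrite -scaler_int dotZr; case: eqP => [->|ne]; first by rewrite -kE ek mulrC.
  by case: (dir w wD) => [->|//]; rewrite !mulr0.
apply: (Nprim k (\row_j (m j)%:~R)).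
  by move=> j; rewrite mxE; exact: intr_int.
by apply/rowP => j; rewrite !mxE hm.
Qed.

(** If all facets met at [v], the whole ray from [v] through the origin would stay in [S], which is
    bounded. *)
Lemma facet_avoiding v : vertex S v -> fs != [::] -> exists2 H, facet S H & ~ H v.
Proof.
move=> vS fs0; apply: contrapT => h; have Sv := vertex_in vS.
have all_v H : facet S H -> H v by move=> fH; apply: contrapT => Hv; apply: h; exists H.
have sl0 H : facet S H -> 0 < facet_slack H 0.
  by move=> fH; rewrite /facet_slack dot0r sub0r oppr_gt0 facet_supp_lt0.
have slv H : facet S H -> facet_slack H v = 0.
  by move=> fH; apply/(facet_slack_eq0 fH Sv); exact: all_v.
have v0 : v != 0.
  have [G /in_facets fG] : exists G, G \in fs.
    by case: (fs) fs0 => // G r _; exists G; exact: mem_head.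
  by apply/eqP => v0; have := sl0 G fG; rewrite -[X in facet_slack G X]v0 slv // ltxx.
have vv := dot_gt0 v0.
have Sray t : 0 <= t -> S (v + t *: (0 - v)).
  move=> t0; rewrite facet_ineqs => G /in_facets fG.
  rewrite -subr_ge0 -/(facet_slack G _) facet_slack_affine -facet_slack_sub slv // subr0 add0r.
  by rewrite mulr_ge0 // ltW // sl0.
(* At this parameter [dot v] takes the value [- (|supp S v| + 1)] on the ray, below its minimum on
   [S]. *)
pose t := 1 + (`|supp S v| + 1) / dot v v.
have p0 : 0 < `|supp S v| + 1 by rewrite ltr_wpDl.
have t0 : 0 <= t := addr_ge0 ler01 (ltW (divr_gt0 p0 vv)).
have e : t * dot v v = dot v v + (`|supp S v| + 1).
  by rewrite /t mulrDl mul1r divfK // gt_eqF.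
have := supp_le pS v (Sray t t0); rewrite sub0r dotDr dotZr dotNr mulrN e => h'.
by have := ler_norm (- supp S v); rewrite normrN; lra.
Qed.

Let facet_slack_int H v : facet S H -> lattice v -> facet_slack H v \is a Num.int.
Proof.
move=> fH vL; have [w wS Hw] := face_has_vertex pS fH.1.
have Sw := vertex_in wS; have := facet_slack_sub H v w.
rewrite (facet_slack_eq0 fH Sw).2 // subr0 => ->.
have [[NL _] _] := facet_normalP fH.
by apply: dot_int => //; apply: lattice_sub => //; exact: vertex_lattice.
Qed.

Let facet_slack_ge1 H v : facet S H -> lattice v -> 0 < facet_slack H v -> 1 <= facet_slack H v.
Proof.
move=> fH vL v0; have := norm_intr_ge1 (facet_slack_int fH vL) (lt0r_neq0 v0).
by rewrite gtr0_norm.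
Qed.

Let smooth_slack_ge1 F v : proper_face S F -> vertex S v -> ~ F v -> 1 <= slack F v.
Proof.
move=> [fF F0 _] vS Fv; have Sv := vertex_in vS.
have [H [fH FH Hv]] : exists H, [/\ facet S H, F `<=` H & ~ H v].
  apply: contrapT => h; apply: Fv; apply: face_facets => // G fG FG.
  by apply: contrapT => Gv; apply: h; exists G.
apply: le_trans (facet_slack_le Sv fH FH); apply: facet_slack_ge1 => //.
  exact: vertex_lattice.
exact: facet_slack_gt0.
Qed.

(** Facet slacks at vertices are integers, so a neighbor of [F] has slack at least 1; a unit edge
    leaving [F] attains this. *)
Lemma smooth_depth F : proper_face S F -> depth S F (face_normal S F) = 1.
Proof.
move=> pF; have [fF F0 _] := pF; have FS := is_face_sub fF.
have lb : lbound [set dot (face_normal S F) y - supp S (face_normal S F) | y in neighbor S F] 1.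
  by move=> _ [y [yS Fy _] <-]; rewrite slackE //; exact: smooth_slack_ge1.
have [v vS Fv] := face_has_vertex pS fF; have [H fH FH] := proper_face_facet pF.
have [Y /(_ H fH (FH _ Fv))[YS HY Y1 GY [E [eE Ev EY]]]] := unit_edge_family vS.
have in1 : [set dot (face_normal S F) y - supp S (face_normal S F) | y in neighbor S F] 1.
  exists (Y H); last first.
    by rewrite slackE // (edge_slack vS Fv fH (vertex_in YS) GY) asboolT.
  by split=> //; [move=> /FH | exists v, E].
apply/eqP; rewrite eq_le; apply/andP; split; first by apply: ge_inf => //; exists 1.
by apply: lb_le_inf => //; exists 1.
Qed.

(* Minimize [g] under the constraint [slack F >= 1] by a Lagrange multiplier [l]
   for which [g - l * slack F] is minimal both at a vertex [v] of [F] and at a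
   vertex outside [F]; it is then also minimal at the end of a unit edge leaving
   [F] at [v]. *)
Lemma smooth_flat F : proper_face S F -> flat S F.
Proof.
move=> pF; have [fF F0 _] := pF; have FS := is_face_sub fF.
rewrite /flat /DTr smooth_depth // TrE //.
have [vs vs0 evs] := vertices_finite pS.
have vsP v : v \in vs <-> vertex S v by rewrite -[vertex S v]/([set v | vertex S v] v) evs.
pose ws := [seq v <- vs | `[< ~ F v >]].
have wsP v : v \in ws <-> vertex S v /\ ~ F v.
  rewrite mem_filter; split=> [/andP[/asboolP Fv /vsP] //|[/vsP vS Fv]].
  by rewrite vS asboolT.
have -> : [set v | vertex S v /\ ~ F v] = [set` ws] by apply/seteqP; split=> v /wsP.
have eF x : dot (face_normal S F) x = supp S (face_normal S F) + slack F x.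
  by rewrite -slackE // addrC subrK.
apply/seteqP; split=> x /=; last first.
  move=> /convP cx; split.
    rewrite facet_ineqs => G _; apply: cx => v /wsP[vS _].
    by apply: supp_le => //; exact: vertex_in.
  rewrite -(lerD2l (supp S (face_normal S F))) -eF; apply: cx => v /wsP[vS Fv].
  by rewrite eF lerD2l smooth_slack_ge1.
move=> [Sx x1]; apply/convP => g c hc.
have [h|] := pselect (forall v, vertex S v -> c <= dot g v); first exact: (vertex_le pS h Sx).
move=> /existsNP[v0 /not_implyP[v0S /negP]]; rewrite -ltNge => gv0.
have Fv0 : F v0.
  by apply: contrapT => Fv0; move: gv0; rewrite ltNge hc //; apply/wsP.
pose zs := [seq v <- vs | `[< F v >]].
have zsP v : v \in zs <-> vertex S v /\ F v.
  rewrite mem_filter; split=> [/andP[/asboolP Fv /vsP] //|[/vsP vS Fv]].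
  by rewrite vS asboolT.
have v0zs : v0 \in zs by apply/zsP.
have zs0 : zs != [::] by apply: contraTneq v0zs => ->.
have [v /zsP[vS Fv] vm] := seq_argmin (dot g) zs0; have Sv := vertex_in vS.
have gv : dot g v < c := le_lt_trans (vm _ v0zs) gv0.
have ws0 : ws != [::].
  apply/eqP => ws0; have : slack F x <= 0.
    have allF w : vertex S w -> F w.
      move=> wS; apply: contrapT => Fw; have : w \in ws by apply/wsP.
      by rewrite ws0.
    rewrite -(lerD2l (supp S (face_normal S F))) -eF addr0 -lerN2 -dotNl.
    apply: (vertex_le pS) Sx => w wS; rewrite dotNl lerN2 eF slack_in ?addr0 //.
    exact: allF.
  lra.
have [w wws wm] := seq_argmin (fun w => (dot g w - dot g v) / slack F w) ws0.
have [wS Fw] := (wsP w).1 wws; have Sw := vertex_in wS.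
set l := (dot g w - dot g v) / slack F w in wm.
have sl0 z : z \in ws -> 0 < slack F z.
  by move=> /wsP[zS Fz]; apply: lt_le_trans ltr01 _; exact: smooth_slack_ge1.
have l0 : 0 <= l.
  rewrite divr_ge0 ?slack_ge0 // subr_ge0 ltW //; apply: lt_le_trans gv _.
  exact: hc.
pose k := g - l *: face_normal S F.
have kE z : dot k z = dot g z - l * supp S (face_normal S F) - l * slack F z.
  by rewrite /k dotBl dotZl eF; ring.
have kmin z : vertex S z -> dot k v <= dot k z.
  move=> zS; rewrite !kE (slack_in FS Fv) mulr0 subr0.
  have [Fz|Fz] := pselect (F z).
    by rewrite (slack_in FS Fz) mulr0 subr0 lerD2r vm //; apply/zsP.
  have zws : z \in ws by apply/wsP.
  by have := wm z zws; rewrite ler_pdivlMr ?sl0 //; lra.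
have kv : face_in S k v.
  by apply: face_in_min => // z Sz; apply: (vertex_le pS kmin Sz).
have kw : dot k w = dot k v.
  rewrite !kE (slack_in FS Fv) mulr0 subr0.
  by have : l * slack F w = dot g w - dot g v; [rewrite divfK // gt_eqF // sl0 | lra].
have [Y hY] := unit_edge_family vS.
have YP H : facet S H -> H v -> [/\ S (Y H), ~ H (Y H) &
    forall G, facet S G -> G v -> G <> H -> G (Y H)].
  by move=> fH Hv; have [YS HY _ GY _] := hY H fH Hv; split=> //; exact: vertex_in.
have [H [fH FH Hw]] : exists H, [/\ facet S H, F `<=` H & ~ H w].
  apply: contrapT => h; apply: Fw; apply: face_facets => // G fG FG.
  by apply: contrapT => Gw; apply: h; exists G.
have [YS HY Y1 GY _] := hY H fH (FH _ Fv).
have SY := vertex_in YS.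
have Fsl : slack F (Y H) = 1 by rewrite (edge_slack vS Fv fH SY GY) asboolT.
have kY : dot k (Y H) = dot k v.
  have := congr1 (dot k) (vertex_cone w vS YP).
  rewrite dot_sumr dotBr kw subrr => /esym/eqP.
  rewrite big_seq_cond psumr_eq0 => [/allP/(_ H)|K /andP[/in_facets fK /asboolP Kv]]; last first.
    have [SYK _ _] := YP K fK Kv.
    rewrite dotZr mulr_ge0 //; first by rewrite divr_ge0 ?facet_slack_ge0.
    by rewrite dotBr subr_ge0 (face_inP pS kv).
  have Hfs : H \in fs by rewrite fsP asboolT.
  rewrite Hfs asboolT; last exact: FH.
  rewrite dotZr mulf_eq0 Y1 divr1 (gt_eqF (facet_slack_gt0 fH Sw Hw)) => /(_ isT) /=.
  by rewrite dotBr subr_eq0 => /eqP.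
have YF : ~ F (Y H) by move=> /FH.
have : c <= dot g (Y H) by apply: hc; apply/wsP.
move: kY (face_inP pS kv Sx); rewrite !kE Fsl (slack_in FS Fv).
have : l * 1 <= l * slack F x by rewrite ler_wpM2l.
lra.
Qed.

(* Every summand is a positive integer and there are at least two facets. *)
Lemma smooth_slack_sum : fs != [::] -> 1 < \sum_(H <- fs) facet_slack H 0.
Proof.
move=> fs0; have S_0 : S 0 := nbhs_singleton S0.
have ge1 H : H \in fs -> 1 <= facet_slack H 0.
  move=> /in_facets fH; apply: facet_slack_ge1 => //.
    by move=> i; rewrite mxE rpred0.
  by rewrite /facet_slack dot0r sub0r oppr_gt0 facet_supp_lt0.
have [G Gfs] : exists G, G \in fs.
  by case: (fs) fs0 => // G r _; exists G; exact: mem_head.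
have [v vS Gv] := face_has_vertex pS (in_facets Gfs).1.
have [H fH Hv] := facet_avoiding vS fs0.
have Hfs : H \in fs by rewrite fsP asboolT.
have HG : H != G by apply/eqP => e; apply: Hv; rewrite e.
rewrite (bigD1_seq G) //= -big_filter (bigD1_seq H) ?filter_uniq //=; last first.
  by rewrite mem_filter HG.
have := ge1 G Gfs; have := ge1 H Hfs.
set r := (X in _ -> _ -> _ < _ + (_ + X)).
have : 0 <= r.
  rewrite /r big_filter_cond big_seq_cond; apply: sumr_ge0 => K _.
  exact: facet_slack_ge0.
lra.
Qed.

(** * The matrix of support values over a building set *)

Context {s : seq (set V)} (us : uniq s) (bS : building_set S [set` s]).
Context (s_ord : forall F G, F \in s -> G \in s -> F `<=` G -> (index F s <= index G s)%N).

Let sP F : F \in s -> proper_face S F. Proof. by case: bS => h _ _; exact: h. Qed.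

Let fs_s F : F \in fs -> F \in s.
Proof. by case: bS => _ h _ /in_facets; exact: h. Qed.

Lemma sum_facets (Q : pred (set V)) (f : set V -> R) :
  \sum_(F <- fs | Q F) f F = \sum_(F <- s | Q F) (if F \in fs then f F else 0).
Proof.
rewrite -[LHS]big_filter -[RHS]big_mkcondr -[RHS]big_filter; apply: perm_big.
apply: uniq_perm; rewrite ?filter_uniq // => F; rewrite !mem_filter.
by case: (boolP (F \in fs)) => [/fs_s->|]; rewrite ?andbT ?andbF.
Qed.

(** Triangularity: the faces strictly containing [G] come after it in [s], so [f] vanishes by
    induction from the end of the list. *)
Lemma sum_supersets_eq0 (f : set V -> R) :
  (forall G, G \in s -> \sum_(F <- s | `[< G `<=` F >]) f F = 0) ->
  forall G, G \in s -> f G = 0.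
Proof.
move=> h; suff : forall k G, G \in s -> (size s - index G s <= k)%N -> f G = 0.
  by move=> hk G Gs; exact: (hk _ G Gs (leqnn _)).
elim=> [|k IH] G Gs.
  by rewrite leqn0 subn_eq0 leqNgt index_mem Gs.
move=> Gk; have := h G Gs; rewrite -big_filter (bigD1_seq G) /=; last 2 first.
- by rewrite mem_filter Gs andbT; apply/asboolP.
- exact: filter_uniq.
rewrite big_filter_cond big_seq_cond big1 ?addr0 //.
move=> F /and3P[Fs /asboolP GF FG]; apply: IH => //.
have : (index G s < index F s)%N.
  rewrite ltn_neqAle s_ord // andbT; apply: contra FG => /eqP e.
  by rewrite -(nth_index set0 Gs) e nth_index.
move=> lt; apply: leq_trans (leq_sub2l _ lt) _.
by rewrite subnS -subn1 leq_subLR add1n.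
Qed.

(* By [supp_Tr] the matrix is of rank one plus triangular for inclusion. *)
Lemma truncation_matrix_inj (eps : set V -> R) (l : set V -> R) :
  (forall F, F \in s -> 0 < eps F <= depth S F (face_normal S F)) ->
  \sum_(H <- fs) facet_slack H 0 / eps H != 1 ->
  (forall G, G \in s -> \sum_(F <- s) l F * supp (Tr (eps F) S F) (face_normal S G) = 0) ->
  forall F, F \in s -> l F = 0.
Proof.
move=> epsP sum1 h; pose C := \sum_(F <- s) l F.
pose b F := if F \in fs then facet_slack F 0 else 0.
(* Both sides have the same sum over the faces containing any [G]: by hypothesis the left one sums
   to [C * slack G 0], and so does the right one by definition of [slack]. *)
have lE F : F \in s -> l F * eps F = C * b F.
  move=> Fs; apply/eqP; rewrite -subr_eq0; apply/eqP; move: F Fs; apply: sum_supersets_eq0.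
  move=> G Gs; have [fG G0 _] := sP Gs.
  rewrite sumrB -mulr_sumr -(sum_facets (fun F => `[< G `<=` F >]) (fun F => facet_slack F 0)).
  rewrite -/(slack G 0) -(slackE 0 (is_face_sub fG) G0) dot0r sub0r.
  apply: etrans (h G Gs); rewrite mulrN opprK.
  transitivity (\sum_(F <- s) (l F * supp S (face_normal S G) +
      (if `[< G `<=` F >] then l F * eps F else 0))).
    by rewrite big_split /= -mulr_suml -big_mkcond addrC.
  apply: eq_big_seq => F Fs; have /andP[e0 ed] := epsP F Fs.
  rewrite supp_Tr //; [|exact: sP|exact: sP].
  by rewrite mulrDr; case: ifP => _; rewrite ?mulr0.
(* Dividing by [eps F] and summing multiplies [C] by a number different from 1. *)
have C0 : C = 0.
  have : C = C * \sum_(H <- fs) facet_slack H 0 / eps H.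
    rewrite (sum_facets predT) mulr_sumr; apply: eq_big_seq => F Fs.
    have /andP[e0 _] := epsP F Fs.
    have -> : l F = l F * eps F / eps F by rewrite mulfK // gt_eqF.
    rewrite lE // /b; case: ifP => _; first by rewrite mulrA.
    by rewrite !mulr0 mul0r.
  move/eqP; rewrite -subr_eq0 -{1}[C]mulr1 -mulrBr mulf_eq0 subr_eq0 [1 == _]eq_sym.
  by rewrite (negPf sum1) orbF => /eqP.
move=> F Fs; have := lE F Fs; rewrite C0 mul0r => /eqP.
have /andP[e0 _] := epsP F Fs.
by rewrite mulf_eq0 (gt_eqF e0) orbF => /eqP.
Qed.

(* [slack / eps] summed over the facets exceeds 1 at every vertex, hence at 0. *)
Lemma shallow_slack_sum (eps : set V -> R) : fs != [::] ->
  (forall F, F \in s -> 0 < eps F < depth S F (face_normal S F)) ->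
  1 < \sum_(H <- fs) facet_slack H 0 / eps H.
Proof.
move=> fs0 epsP; have S_0 : S 0 := nbhs_singleton S0.
have e0 H : H \in fs -> 0 < eps H by move=> /fs_s/epsP/andP[].
pose g := \sum_(H <- fs) (eps H)^-1 *: N H.
have [v vS vg] := supp_vertex g pS; have Sv := vertex_in vS.
have [H fH Hv] := facet_avoiding vS fs0.
have Hfs : H \in fs by rewrite fsP asboolT.
have /andP[_ eH] := epsP H (fs_s Hfs).
have h1 : 1 < \sum_(H <- fs) facet_slack H v / eps H.
  rewrite (bigD1_seq H) //= ltr_wpDr //.
    rewrite big_seq_cond sumr_ge0 // => K /andP[Kfs _].
    by rewrite divr_ge0 ?facet_slack_ge0 // ltW // e0.
  rewrite ltr_pdivlMr ?e0 // mul1r -slack_facet //.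
  by apply: lt_le_trans eH _; apply: slack_ge_depth => //; exact: facet_proper.
apply: lt_le_trans h1 _; rewrite -subr_ge0 -sumrB.
have := face_inP pS vg S_0; rewrite -subr_ge0 -dotBr /g dot_suml.
rewrite (_ : \sum_(i <- fs) dot _ _ =
  \sum_(i <- fs) (facet_slack i 0 / eps i - facet_slack i v / eps i)) //.
by apply: eq_bigr => K _; rewrite dotZl -facet_slack_sub; ring.
Qed.

(** * The successive truncations and their active constraints *)

Context {e0 : set V -> R}.
Let T i := truncation_step S s e0 i.
Let nF i := nth set0 s i.
Context (shT : forall i, (i < size s)%N ->
  shallow (T i) (nF i `&` T i) (face_normal S (nF i)) (e0 (nF i))).

Let nFs i : (i < size s)%N -> nF i \in s. Proof. exact: mem_nth. Qed.

Let T0 : T 0 = S. Proof. by rewrite /T /truncation_step take0. Qed.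

Let TS i : (i < size s)%N -> T i.+1 = truncation (T i) (face_normal S (nF i)) (e0 (nF i)).
Proof. by move=> lt; rewrite /T /truncation_step (take_nth set0 lt) foldl_rcons. Qed.

Let T_sub i : (i <= size s)%N -> T i `<=` S.
Proof.
by elim: i => [|i IH] lt; rewrite ?T0 // TS // => x [Tx _]; apply: (IH (ltnW lt)).
Qed.

Let eps0_gt0 F : F \in s -> 0 < e0 F.
Proof.
move=> /(nthP set0)[i lt <-]; have [_ /andP[]] := shT lt; by [].
Qed.

(** Shallowness includes that the face to be cut still has a point in [T i], so the minimum over [S]
    is still attained. *)
Let supp_T i : (i < size s)%N -> supp (T i) (face_normal S (nF i)) = supp S (face_normal S (nF i)).
Proof.
move=> lt; have [[_ [x [Fx Tx]] _] _] := shT lt.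
have [fF F0 _] := sP (nFs lt); have FS := is_face_sub fF.
have xu : face_in S (face_normal S (nF i)) x by rewrite face_in_normal.
rewrite -xu.2; apply: suppE => // y /(T_sub (ltnW lt)) Sy.
exact: (face_inP pS xu Sy).
Qed.

Let dot_slack F x y : F \in s ->
  dot (face_normal S F) x - dot (face_normal S F) y = slack F x - slack F y.
Proof.
by move=> /sP[fF F0 _]; rewrite -!slackE //; [lra| |]; exact: is_face_sub.
Qed.

Let TP i : (i <= size s)%N ->
  T i = [set x | S x /\ forall F, F \in s -> (index F s < i)%N -> e0 F <= slack F x].
Proof.
elim: i => [|i IH] lt.
  by rewrite T0; apply/seteqP; split=> x //= [].
rewrite TS // /truncation supp_T // {1}(IH (ltnW lt)).
have Fs := nFs lt; have [fF F0 _] := sP Fs; have FS := is_face_sub fF.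
have iF : index (nF i) s = i by rewrite index_uniq.
apply/seteqP; split=> x /=.
  move=> [[Sx h] hx]; split=> // G Gs; rewrite ltnS leq_eqVlt => /predU1P[Gi|]; last exact: h.
  have -> : G = nF i by rewrite /nF -Gi nth_index.
  by rewrite -slackE //; lra.
move=> [Sx h]; split; first by split=> // G Gs Gi; apply: h => //; exact: ltnW.
by have := h (nF i) Fs; rewrite iF leqnn => /(_ isT); rewrite -slackE //; lra.
Qed.

Let face_T i : (i < size s)%N -> face_in (T i) (face_normal S (nF i)) = nF i `&` T i.
Proof.
move=> lt; have [fF F0 _] := sP (nFs lt).
rewrite -{2}(face_in_normal fF F0); apply/seteqP; split=> x.
  by move=> [Tx ux]; split=> //; split; [exact: (T_sub (ltnW lt)) | rewrite -supp_T].
by move=> [[Sx ux] Tx]; split=> //; rewrite supp_T.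
Qed.

(** Each cut leaves a nonempty set: the cut face is proper, so some vertex is off it, and this
    vertex lies at least the depth above it. *)
Let polytope_T i : (i <= size s)%N -> polytope (T i).
Proof.
elim: i => [|i IH] lt; first by rewrite T0.
have pT := IH (ltnW lt); rewrite TS //; apply: polytope_truncation => //.
have [[_ _ FT] /andP[_ ed]] := shT lt.
suff [v vT vF] : exists2 v, vertex (T i) v & ~ face_in (T i) (face_normal S (nF i)) v.
  exists v; split; first exact: vertex_in.
  have := depth_le_vertex pT vT vF; rewrite face_T //; lra.
apply: contrapT => h; apply: FT; apply/seteqP; split=> x; first by case.
move=> Tx; rewrite -face_T //; split=> //; apply/eqP; rewrite eq_le supp_le // andbT.
rewrite -lerN2 -dotNl; apply: (vertex_le pT) Tx => v vT; rewrite dotNl lerN2.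
have [_ ->] // : face_in (T i) (face_normal S (nF i)) v.
by apply: contrapT => vF; apply: h; exists v.
Qed.

Local Notation P := (T (size s)).

Let active x F := F \in s /\ slack F x = e0 F.

(* Undoing the truncations one at a time: a point of [P] is moved back to the
   faces defining its active constraints. *)
Let backtrack x m : P x -> (m <= size s)%N -> exists2 y, T m y &
  forall F, active x F -> slack F y = if (index F s < m)%N then e0 F else 0.
Proof.
move=> Px; suff h k : (k <= size s)%N -> exists2 y, T (size s - k) y &
    forall F, active x F -> slack F y = if (index F s < size s - k)%N then e0 F else 0.
  by move=> le; have := h _ (leq_subr m _); rewrite subKn.
elim: k => [|k IH] lt.
  rewrite subn0; exists x => // F [Fs Fx].
  by rewrite index_mem Fs.
have [y' Ty' hy'] := IH (ltnW lt).
set i := (size s - k.+1)%N; have ei : (size s - k)%N = i.+1 by rewrite /i subnSK.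
have li : (i < size s)%N by rewrite -ei leq_subr.
rewrite ei in Ty' hy'; have Ty'i : T i y' by move: Ty'; rewrite TS // => -[].
have iF : index (nF i) s = i by rewrite index_uniq.
have idx F : F \in s -> F <> nF i -> (index F s < i.+1)%N = (index F s < i)%N.
  move=> Fs Fi; rewrite ltnS leq_eqVlt; case: eqP => // Fi'.
  by case: Fi; rewrite /nF -Fi' nth_index.
have [aF|naF] := pselect (active x (nF i)); last first.
  exists y' => // F aF; rewrite hy' // idx //; first by case: aF.
  by move=> e; apply: naF; rewrite -e.
(* The other active constraints at stage [i] define a face of [T i] through [y']; as the cut is
   shallow, [shallow_meets_face] moves [y'] within it to the face [nF i]. *)
pose on F := (F != nF i) && `[< active x F >].
pose g := \sum_(F <- s | on F) face_normal S F.
have onP F : on F -> F \in s /\ F <> nF i /\ active x F.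
  by move=> /andP[/eqP Fi /asboolP aG]; split=> //; case: aG.
have gE z : dot g z - dot g y' = \sum_(F <- s | on F) (slack F z - slack F y').
  by rewrite !dot_suml -sumrB; apply: eq_bigr => F /onP[Fs _]; exact: dot_slack.
have term_ge0 z F : T i z -> on F -> 0 <= slack F z - slack F y'.
  move=> Tz /onP[Fs [Fi aG]]; rewrite subr_ge0 hy' // idx //.
  case: ifP => [lt'|_]; last exact: slack_ge0 (T_sub (ltnW li) Tz).
  by move: Tz; rewrite TP ?(ltnW li) // => -[_]; apply.
have gy' : face_in (T i) g y'.
  apply: face_in_min => // z Tz; rewrite -subr_ge0 gE; apply: sumr_ge0 => F onF.
  exact: term_ge0.
have [_ /andP[_ ed]] := shT li; rewrite -face_T // in ed.
have uy' : dot (face_normal S (nF i)) y' <= supp (T i) (face_normal S (nF i)) + e0 (nF i).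
  have [fF F0 _] := sP (nFs li).
  have := slackE y' (is_face_sub fF) F0; rewrite hy' // iF ltnSn supp_T //; lra.
have [y gy] := shallow_meets_face (polytope_T (ltnW li)) ed gy' uy'.
rewrite face_T // => -[Fy Ty]; exists y => // F aG; have Fs := aG.1.
have Sy := T_sub (ltnW li) Ty.
have [->|/eqP Fi] := eqVneq F (nF i).
  by rewrite iF ltnn slack_in //; apply: is_face_sub; case: (sP (nFs li)).
rewrite -idx // -hy' //; apply/eqP; rewrite -subr_eq0.
have := gE y; rewrite gy.2 -gy'.2 subrr => /esym/eqP.
rewrite psumr_eq0 => [/allP/(_ F Fs)|K]; last exact: term_ge0.
by rewrite /on (introN eqP Fi) asboolT.
Qed.

(** Backtracking to stage 0 gives a point on all active faces; it minimizes the sum of their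
    normals, so any vertex minimizing this sum lies on them too. *)
Let active_common x : P x -> exists2 w, vertex S w & forall F, active x F -> F w.
Proof.
move=> Px; have [y Sy hy] := backtrack Px (leq0n _).
rewrite T0 in Sy; pose g := \sum_(F <- s | `[< active x F >]) face_normal S F.
have gE z : dot g z - dot g y = \sum_(F <- s | `[< active x F >]) slack F z.
  rewrite !dot_suml -sumrB; apply: eq_bigr => F /asboolP aF.
  by rewrite dot_slack ?hy ?subr0 //; case: aF.
have gy : face_in S g y.
  apply: face_in_min => // z Sz; rewrite -subr_ge0 gE; apply: sumr_ge0 => F _.
  exact: slack_ge0.
have [w wS gw] := supp_vertex g pS; exists w => // F aF; have Sw := vertex_in wS.
have [fF F0 _] := sP aF.1; apply/(slack_eq0 fF F0 Sw)/eqP.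
have := gE w; rewrite gw.2 -gy.2 subrr => /esym/eqP.
rewrite psumr_eq0 => [/allP/(_ F aF.1)|K _]; last exact: slack_ge0.
by rewrite asboolT.
Qed.

(* If the intersection [K] of some active faces is in the building set, it was
   cut off before them unless it is one of them. *)
Let active_inter x (X : set (set V)) K : P x -> X `<=` active x -> K \in s ->
  (forall F, X F -> K `<=` F) -> (forall y, S y -> (forall F, X F -> F y) -> K y) -> X K.
Proof.
move=> Px Xa Ks KX XK; apply: contrapT => nXK.
have lK : (index K s < size s)%N by rewrite index_mem.
have [y Ty hy] := backtrack Px lK.
have Sy := T_sub lK Ty.
have Ky : K y.
  apply: XK => // F XF; have aF := Xa F XF; have [fF F0 _] := sP aF.1.
  apply/(slack_eq0 fF F0 Sy); rewrite hy // ltnS leqNgt.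
  suff -> : (index K s < index F s)%N by [].
  rewrite ltn_neqAle s_ord ?andbT //; [|exact: aF.1|exact: KX].
  apply/eqP => e; apply: nXK; rewrite -(nth_index set0 Ks) e nth_index //; exact: aF.1.
have [fK _ _] := sP Ks.
move: Ty; rewrite TP // => -[_ /(_ K Ks (ltnSn _))].
by rewrite slack_in //; [rewrite leNgt eps0_gt0 | exact: is_face_sub].
Qed.

(* Otherwise the active faces not in [G] covering the facets of [G] meet in a
   subset of [G] that is in the building set, so is active and not in [G]. *)
Let free_facet x w G : P x -> (forall F, active x F -> F w) -> G \in s -> G w ->
  exists2 H, facet S H /\ G `<=` H & forall F, active x F -> F `<=` H -> F `<=` G.
Proof.
move=> Px xw Gs Gw; have pG := sP Gs; have [fG G0 _] := pG; apply: contrapT => h.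
pose X F := [/\ active x F, ~ F `<=` G & exists H, [/\ facet S H, G `<=` H & F `<=` H]].
have XH H : facet S H -> G `<=` H -> exists2 F, X F & F `<=` H.
  move=> fH GH; apply: contrapT => h'; apply: h; exists H => // F aF FH.
  apply: contrapT => FG; apply: h'; exists F => //; split=> //; by exists H.
have inter (r : seq (set V)) : (forall F, F \in r -> X F) ->
    [set y | G y /\ forall F, F \in r -> F y] \in s.
  elim: r => [|F r IH] rX.
    suff -> : [set y | G y /\ forall F, F \in [::] -> F y] = G by [].
    by apply/seteqP; split=> y //= [].
  have [aF _ [H [fH GH FH]]] := rX F (mem_head _ _).
  have rX' K : K \in r -> X K by move=> Kr; apply: rX; rewrite inE Kr orbT.
  case: bS => _ _ /(_ _ F (IH rX') aF.1) bI.
  suff -> : [set y | G y /\ forall K, K \in F :: r -> K y] =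
      [set y | G y /\ forall K, K \in r -> K y] `&` F.
    apply: bI; last by exists H; split=> // y [/GH].
    by exists w; split; [split=> // K /rX'[/xw] | exact: xw].
  apply/seteqP; split=> y.
    move=> [Gy hy]; split; last by apply: hy; rewrite mem_head.
    by split=> // K Kr; apply: hy; rewrite inE Kr orbT.
  move=> [[Gy hy] Fy]; split=> // K; rewrite inE => /predU1P[->//|]; exact: hy.
pose r := [seq F <- s | `[< X F >]].
have rP F : F \in r <-> X F.
  rewrite mem_filter; split=> [/andP[/asboolP]//|XF]; rewrite asboolT //=.
  by case: XF => -[].
set K := [set y | G y /\ forall F, F \in r -> F y].
have Ks : K \in s by apply: inter => F /rP.
have [_ nKG _] : X K.
  apply: (@active_inter x) => //.
  - by move=> F [].
  - by move=> F /rP Fr y [_]; exact.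
  - move=> y Sy hy; split; last by move=> F /rP; exact: hy.
    apply: face_facets => // H fH GH; have [F XF FH] := XH H fH GH.
    by apply: FH; exact: hy.
by apply: nKG => y [].
Qed.

(** The facet inequalities of [S] are implied, because every facet is in [s] with a positive cut. *)
Let P_ineqs : P = [set y | forall F, F \in s ->
  supp S (face_normal S F) + e0 F <= dot (face_normal S F) y].
Proof.
rewrite TP //; apply/seteqP; split=> y /=.
  move=> [Sy h] F Fs; have [fF F0 _] := sP Fs; have := h F Fs.
  by rewrite index_mem Fs -(slackE y (is_face_sub fF) F0) => /(_ isT); lra.
move=> h; have sl F : F \in s -> e0 F <= slack F y.
  move=> Fs; have [fF F0 _] := sP Fs.
  by rewrite -(slackE y (is_face_sub fF) F0); have := h F Fs; lra.
split=> [|F Fs _]; last exact: sl.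
rewrite facet_ineqs => H Hfs; rewrite -subr_ge0 -/(facet_slack H y).
rewrite -(slack_facet y (in_facets Hfs)); apply: le_trans _ (sl H (fs_s Hfs)).
by rewrite ltW // eps0_gt0 // fs_s.
Qed.

Let truncation_cover (e : R) G x : G \in s -> 0 < e ->
  e <= depth S G (face_normal S G) -> P x ->
  exists2 y, Tr e S G y & forall u, face_in P u x -> face_in (Tr e S G) u y.
Proof.
move=> Gs ep ed Px; have pG := sP Gs.
have [w wS xw] := active_common Px.
have [F aF|Gw|y Ty hy] := truncation_point (X := active x) pG ep ed wS.
- by split; [apply: is_face_sub; case: (sP aF.1) | exact: xw].
- exact: (free_facet Px xw Gs Gw).
exists y => // u ux.
have [l l0 eu] := farkas_active us (polytope_T (leqnn _)) P_ineqs ux.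
apply: face_in_min => // z Tz; rewrite -subr_ge0 eu !dot_suml -sumrB.
rewrite big_seq_cond; apply: sumr_ge0 => F /andP[Fs /eqP Fx].
rewrite !dotZl -mulrBr mulr_ge0 // dot_slack //.
have [fF F0 _] := sP Fs; have aF : active x F.
  by split=> //; rewrite -(slackE x (is_face_sub fF) F0) Fx; lra.
move: Tz; rewrite hy // TrE // subr_ge0 => -[Sz ez].
case: asboolP => [FG|_]; last exact: slack_ge0.
exact: le_trans (slack_antitone Sz FG).
Qed.

Lemma truncations_polytopal_basis (eps : set V -> R) :
  (forall F, F \in s -> 0 < eps F <= depth S F (face_normal S F)) ->
  \sum_(H <- fs) facet_slack H 0 / eps H != 1 ->
  polytopal_basis (normal_fan P) [set` s] (fun F => Tr (eps F) S F) /\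
  normally_equivalent (minkowski_sum [set` s] (fun F => Tr (eps F) S F)) P.
Proof.
move=> epsP sum1; apply: (polytopal_basis_criterion us (polytope_T (leqnn _)) P_ineqs).
- by move=> F Fs; have /andP[ep ed] := epsP F Fs; apply: polytope_Tr => //; exact: sP.
- by move=> F Fs x Px; have /andP[ep ed] := epsP F Fs; exact: truncation_cover.
- by move=> l; exact: truncation_matrix_inj.
Qed.

End FacetNormals.

End TruncationBases.

Theorem theorem1p2 (R : realType) (n : nat) (S : set 'rV[R]_n)
    (B : set (set 'rV[R]_n)) (P : set 'rV[R]_n) :
  simple_polytope S -> rational_facets S -> interior S 0 ->
  building_set S B -> building_truncation S B P ->
  (forall eps : set 'rV[R]_n -> R,
     (forall F, B F -> shallow_face S F (eps F)) ->
     polytopal_basis (normal_fan P) B (fun F => Tr (eps F) S F) /\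
     normally_equivalent (minkowski_sum B (fun F => Tr (eps F) S F)) P) /\
  (smooth_polytope S -> (forall E, edge S E -> lattice_length1 E) ->
     (forall F, B F -> flat S F) /\
     polytopal_basis (normal_fan P) B (fun F => DTr S F)).
Proof.
move=> [pS dS simpS] rS S0 bS [s [e0 [[us eB] ord sh ->]]].
rewrite -eB in bS *.
have [fs [ufs fsP]] := facets_seq pS.
have sP F : F \in s -> proper_face S F by case: bS => h _ _; exact: h.
have basis := truncations_polytopal_basis pS dS S0 rS ufs fsP simpS us bS ord sh.
split=> [eps shal|smS len1].
  have epsP F : F \in s -> 0 < eps F < depth S F (face_normal S F) by move=> /shal[].
  apply: basis => [F /epsP/andP[-> /ltW->] //|].
  (* Without facets the sum is 0, still different from 1. *)
  have [fs0|fs0] := eqVneq fs [::]; first by rewrite fs0 big_nil eq_sym oner_eq0.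
  by rewrite gt_eqF // (shallow_slack_sum pS dS S0 rS ufs fsP bS fs0 epsP).
have depth1 := smooth_depth pS dS S0 rS ufs fsP simpS smS len1.
split=> [F Fs|]; first exact: (smooth_flat pS dS S0 rS ufs fsP simpS smS len1 (sP F Fs)).
(* Deep truncations are the case where [eps] equals the depth, here 1 for every face. *)
apply: (basis (fun F => depth S F (face_normal S F)) _ _).1 => [F Fs|].
  by rewrite lexx andbT depth1 ?ltr01 //; exact: sP.
have [fs0|fs0] := eqVneq fs [::]; first by rewrite fs0 big_nil eq_sym oner_eq0.
rewrite (eq_big_seq (fun H => @facet_slack _ _ S H 0)) => [|H]; last first.
  by rewrite fsP => /asboolP fH; rewrite depth1 ?divr1 //; exact: (facet_proper dS).
by rewrite gt_eqF // (smooth_slack_sum pS dS S0 rS ufs fsP smS fs0).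
Qed.
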